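(* Let $\beta>0$ and let $\mathsf W$ be a symmetric, $H_0$-form-compact operator on $L^2(\mathbb R^3)$, where $H_0=-\Delta$ with domain $H^{2,0}$, such that $\mathsf W$ defines a compact operator from $H^{1,-\beta/2}$ to $H^{-1,\beta/2}$ (also denoted $\mathsf W$). Let $\mathscr K=\ell^2(\mathbb N)$ if $\operatorname{rank}\mathsf W=\infty$, and $\mathscr K=\mathbb C^{\operatorname{rank}\mathsf W}$ otherwise. Then there exist a bounded operator $\mathsf w:H^{1,-\beta/2}\to\mathscr K$ and a self-adjoint and unitary operator $\mathsf U$ on $\mathscr K$ such that $$\mathsf W=\mathsf w^*\mathsf U\mathsf w .$$
   Context: $\langle x\rangle=(1+|x|^2)^{1/2}$. For $k,s\in\mathbb R$, $H^{k,s}=H^{k,s}(\mathbb R^3)$ is the completion of the Schwartz space in the norm $\|\langle x\rangle^s(1-\Delta)^{k/2}u\|_{L^2(\mathbb R^3)}$. The $L^2$ inner product extends to a duality between $H^{k,s}$ and $H^{-k,-s}$, with respect to which $\mathsf w^*:\mathscr K\to H^{-1,\beta/2}$ is the adjoint of $\mathsf w$. *)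

(* Defs.v *)
From HB Require Import structures.
From mathcomp Require Import all_boot all_order all_algebra.
From mathcomp Require Import all_classical all_reals all_analysis.
From mathcomp Require Import complex ring.

Set Implicit Arguments.
Unset Strict Implicit.
Unset Printing Implicit Defensive.

Import Order.TTheory GRing.Theory Num.Theory.
Import numFieldNormedType.Exports.

Local Open Scope classical_set_scope.
Local Open Scope ring_scope.
Local Open Scope complex_scope.

Local Notation normc := ComplexField.Normc.normc.

Section Euclidean3.
Variable R : realType.
Implicit Types (x xi : R * R * R) (g : R * R * R -> R) (u v : R * R * R -> R[i]).

Local Notation mR := (measurableTypeR R).

Definition leb3 : {measure set (mR * mR * mR) -> \bar R} :=
  ((@lebesgue_measure R \x @lebesgue_measure R) \x @lebesgue_measure R)%E.

Definition dot3 x xi : R := x.1.1 * xi.1.1 + x.1.2 * xi.1.2 + x.2 * xi.2.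

Definition japanese x : R := Num.sqrt (1 + dot3 x x).

Definition basis3 (j : 'I_3) : R * R * R :=
  ((j == 0 :> nat)%:R, (j == 1%N :> nat)%:R, (j == 2%N :> nat)%:R).

Definition partials (s : seq 'I_3) g : R * R * R -> R :=
  foldr (fun j h => 'D_(basis3 j) h) g s.

(* All iterated partial derivatives exist and are bounded, hence all of them
   are continuous and g is smooth. *)
Definition schwartz_real g : Prop :=
  forall s : seq 'I_3,
    (forall x (j : 'I_3), derivable (partials s g) x (basis3 j)) /\
    (forall N : nat, exists M : R,
       forall x, japanese x ^+ N * `|partials s g x| <= M).

Definition schwartz u : Prop :=
  schwartz_real (fun x => complex.Re (u x)) /\
  schwartz_real (fun x => complex.Im (u x)).

Definition Cintegral u : R[i] :=
  (\int[leb3]_x complex.Re (u x)) +i* (\int[leb3]_x complex.Im (u x)).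

Definition expi (t : R) : R[i] := cos t +i* sin t.

Definition fourier u xi : R[i] :=
  ((2 * pi) `^ (- (3 / 2)))%:C * Cintegral (fun x => expi (- dot3 x xi) * u x).

Definition inv_fourier u x : R[i] :=
  ((2 * pi) `^ (- (3 / 2)))%:C * Cintegral (fun xi => expi (dot3 x xi) * u xi).

(* (1 - Delta)^(k/2), the Fourier multiplier (1 + |xi|^2)^(k/2) = <xi>^k. *)
Definition bessel (k : R) u : R * R * R -> R[i] :=
  inv_fourier (fun xi => (japanese xi `^ k)%:C * fourier u xi).

Definition sobolev_norm (k s : R) u : \bar R :=
  Lnorm leb3 2%:E (fun x => (japanese x `^ s * normc (bessel k u x))%:E).

Definition L2_inner u v : R[i] := Cintegral (fun x => u x * (v x)^*).

End Euclidean3.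

(* A model of H^{k,s}: a completion of the Schwartz space. Completions are
   unique up to a unique isometric isomorphism compatible with [embed]. *)
Record sobolev (R : realType) (k s : R) := Sobolev {
  sobolev_sort :> completeNormedModType R[i] ;
  embed : (R * R * R -> R[i]) -> sobolev_sort ;
  embed_linear : forall a u v, schwartz u -> schwartz v ->
    embed (a *: u + v) = a *: embed u + embed v ;
  embed_norm : forall u, schwartz u ->
    (complex.Re `|embed u|)%:E = sobolev_norm k s u ;
  embed_dense : dense (embed @` [set u | schwartz u]) }.

Arguments embed {R k s}.

Definition conj_linear (R : realType) (V : lmodType R[i]) (phi : V -> R[i]) :=
  forall a u v, phi (a *: u + v) = a^* * phi u + phi v.

(* The duality extending the L^2 inner product: a bounded form, linear in its
   first argument and conjugate linear in the second, which identifies [Hd]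
   with the antidual of [H]. As Schwartz functions are dense, there is at most
   one such form. *)
Record L2_duality (R : realType) (k' s' k s : R)
    (Hd : sobolev k' s') (H : sobolev k s) := L2Duality {
  pairing :> Hd -> H -> R[i] ;
  pairing_linear : forall u, scalar (pairing^~ u) ;
  pairing_conj_linear : forall f, conj_linear (pairing f) ;
  pairing_bounded : exists M : R[i],
    forall f u, `|pairing f u| <= M * `|f| * `|u| ;
  pairing_L2 : forall u v, schwartz u -> schwartz v ->
    pairing (embed Hd u) (embed H v) = L2_inner u v ;
  pairing_perfect : forall phi : H -> R[i], conj_linear phi ->
    (exists M : R[i], forall u, `|phi u| <= M * `|u|) ->
    exists! f : Hd, forall u, pairing f u = phi u }.

Section Operators.
Variable R : realType.

Definition compact_operator (V W : normedModType R[i]) (T : V -> W) : Prop :=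
  forall A : set V, bounded_set A -> precompact (T @` A).

Definition has_rank (V W : lmodType R[i]) (T : V -> W) (n : nat) : Prop :=
  exists e : 'I_n -> W,
    (forall c : 'I_n -> R[i], \sum_i c i *: e i = 0 -> forall i, c i = 0) /\
    range T = [set \sum_i c i *: e i | c in [set: 'I_n -> R[i]]].

Definition infinite_rank (V W : lmodType R[i]) (T : V -> W) : Prop :=
  forall n, ~ has_rank T n.

(* A symmetric H_0-form-compact operator: the form domain of H_0 = - Delta is
   H^{1,0}, whose norm is u |-> (((H_0 + 1) u, u))^(1/2), and the antidual of
   the form domain is H^{-1,0}. *)
Definition symmetric_form_compact (H1 : sobolev (1 : R) 0)
    (Hm1 : sobolev (-1 : R) 0) (B : L2_duality Hm1 H1)
    (W : {linear H1 -> Hm1}) : Prop :=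
  (forall u v, B (W u) v = (B (W v) u)^*) /\ compact_operator W.

(* [W'] is the operator defined by [W] between other Sobolev spaces: the two
   have the same form on the Schwartz space, which is dense in all of them. *)
Definition same_form (k1' s1' k1 s1 k2' s2' k2 s2 : R)
    (Hd1 : sobolev k1' s1') (H1 : sobolev k1 s1) (B1 : L2_duality Hd1 H1)
    (Hd2 : sobolev k2' s2') (H2 : sobolev k2 s2) (B2 : L2_duality Hd2 H2)
    (W : {linear H1 -> Hd1}) (W' : {linear H2 -> Hd2}) : Prop :=
  forall u v, schwartz u -> schwartz v ->
    B1 (W (embed H1 u)) (embed H1 v) = B2 (W' (embed H2 u)) (embed H2 v).

Definition square_summable : {pred nat -> R[i]} :=
  fun a => `[< cvgn (series (fun n => normc (a n) ^+ 2)) >].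

Lemma square_summable_closed : submod_closed square_summable.
Proof.
split=> [|c a b /asboolP sa /asboolP sb]; apply/asboolP.
  rewrite (_ : series _ = fun=> 0); first exact: is_cvg_cst.
  apply/funext => n; rewrite /series /= big1 // => i _.
  by rewrite /= expr0n /= add0r sqrtr0 expr0n.
apply: (@series_le_cvg _ _
  (2 * normc c ^+ 2 *: (fun n => normc (a n) ^+ 2) +
   (2 : R) *: (fun n => normc (b n) ^+ 2))).
- by move=> n; exact: sqr_ge0.
- by move=> n; rewrite !fctE addr_ge0 // mulr_ge0 ?sqr_ge0 // mulr_ge0 ?sqr_ge0.
- move=> n; rewrite !fctE.
  have norm_ge0 (z : R[i]) : 0 <= normc z by case: z => x y; exact: sqrtr_ge0.
  have := le_normcD (c * a n) (b n).
  rewrite (ComplexField.Normc.normcM c (a n)) => le_norm.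
  apply: (@le_trans _ _ ((normc c * normc (a n) + normc (b n)) ^+ 2)).
    by rewrite lerXn2r ?nnegrE ?addr_ge0 ?mulr_ge0.
  rewrite -subr_ge0.
  rewrite (_ : _ - _ = (normc c * normc (a n) - normc (b n)) ^+ 2) ?sqr_ge0 //.
  by rewrite /GRing.scale /=; ring.
- by apply: is_cvg_seriesD; apply: is_cvg_seriesZ.
Qed.

HB.instance Definition _ :=
  GRing.isSubmodClosed.Build _ _ square_summable square_summable_closed.

Record ell2 := Ell2 { ell2_val :> nat -> R[i] ;
                      _ : ell2_val \in square_summable }.
HB.instance Definition _ := [isSub for ell2_val].
HB.instance Definition _ := [Choice of ell2 by <:].
HB.instance Definition _ := [SubChoice_isSubLmodule of ell2 by <:].

Definition ell2_dot (a b : ell2) : R[i] :=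
  limn (series (fun n => complex.Re (a n * (b n)^*))) +i*
  limn (series (fun n => complex.Im (a n * (b n)^*))).

Definition Cn_dot (n : nat) (a b : 'rV[R[i]]_n) : R[i] :=
  \sum_i a 0 i * (b 0 i)^*.

(* W = w* U w through the space [K] with inner product [dot]; [wadj] is w*,
   characterized by its being the adjoint of [w] for the duality [B]. *)
Definition factorizes (k' s' k s : R) (Hd : sobolev k' s') (H : sobolev k s)
    (B : L2_duality Hd H) (W : {linear H -> Hd})
    (K : lmodType R[i]) (dot : K -> K -> R[i]) : Prop :=
  exists (w : {linear H -> K}) (wadj : {linear K -> Hd}) (U : {linear K -> K}),
    [/\ exists M : R[i], forall u, sqrtC (dot (w u) (w u)) <= M * `|u|,
        forall a u, B (wadj a) u = dot a (w u),
        forall a b, dot (U a) b = dot a (U b),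
        (forall a b, dot (U a) (U b) = dot a b) /\ (forall b, exists a, U a = b)
      & forall u, W u = wadj (U (w u))].

End Operators.

(* Main.v *)
From HB Require Import structures.
Require Import Defs.
From mathcomp Require Import all_boot all_order all_algebra.
From mathcomp Require Import all_classical all_reals all_analysis.
From mathcomp Require Import measurable_realfun.
From mathcomp Require Import finmap complex ring lra.

(* The compactness of W makes its range separable, and the range lies in the
   Hilbert space Hd = H^{-1,beta/2}; Gram-Schmidt gives an orthogonal sequence
   (e_n) in Hd, each e_n being zero or a unit vector, with
   W u = sum_n (W u, e_n) e_n. Hence
   <W u, v> = sum_n a_n(u) conj(b_n(v)) with a_n(u) = (W u, e_n) and
   b_n(v) = conj <e_n, v>, both square summable with l^2 norm O(|u|). As the
   form is hermitian it is also sum_n b_n(u) conj(a_n(v)), and the average of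
   the two sums is
   sum_n [(a_n + b_n)/2](u) conj[(a_n + b_n)/2](v)
       - [(a_n - b_n)/2](u) conj[(a_n - b_n)/2](v),
   so that w = ((a_n +- b_n)/2) and U = diag(1, -1, 1, -1, ...) will do: no
   spectral theorem is needed. In finite rank the form is diagonalised by the
   spectral theorem for hermitian matrices.
   That Hd is a Hilbert space needs the linearity and measurability of
   u |-> (1 - Delta)^(-1/2) u on the Schwartz space, which come from the decay
   |fourier u (xi)| <= C / prod_j (1 + xi_j^2). *)

Set Implicit Arguments.
Unset Strict Implicit.
Unset Printing Implicit Defensive.

Import Order.TTheory GRing.Theory Num.Theory.
Import numFieldNormedType.Exports.
Local Open Scope ring_scope.
Local Open Scope classical_set_scope.

Local Notation mR := measurableTypeR.

(** * Measurability and integrability on R^3 *)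

(** The model of H^{k,s} supplies a norm and dense Schwartz functions but no inner product, so
    orthogonality in [Hd] has to be won from the norm. On Schwartz functions the squared norm is the
    integral of a quadratic expression in [bessel k u], and the polar identity holds pointwise as
    soon as [bessel k] is linear. Integrals are additive only under integrability, hence the
    estimates. For order -1 the multiplier <xi>^(-1) is at most 1, so the decay of [fourier u]
    suffices; neither Plancherel nor Fourier inversion enters. This is why the orthogonal sequence
    lives in [Hd] and not in [H], whose order is +1: of [H] only the norm, the dense Schwartz
    functions and the duality are used, and w* comes from the perfectness of the pairing.
    Interleaving (a_n + b_n)/2 with (a_n - b_n)/2 doubles the number of coordinates. This is
    harmless in l^2 but does not fit into C^n with n the rank, hence the separate argument in finite
    rank. Symmetry is given for an operator between other spaces and reaches [W] only through the
    common form on Schwartz functions. *)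

Lemma measurable_separately_continuous d (T : measurableType d) (R : realType)
    (f : T * mR R -> R) :
  (forall z, measurable_fun setT (fun t => f (t, z))) ->
  (forall t, continuous (fun z : R => f (t, z))) -> measurable_fun setT f.
Proof.
move=> mf cf.
(* Freezing the second variable at the left end of its cell of length 1/(n+1) gives [fn n], which
   converges pointwise to [f] by continuity in that variable. *)
pose r (n : nat) (k : int) : R := k%:~R / n.+1%:R.
pose fn (n : nat) (p : T * mR R) : R := f (p.1, r n (Num.floor (n.+1%:R * (p.2 : R)))).
apply: (@measurable_realfun.measurable_fun_cvg _ _ _ _ fn).
- move=> n _ Y mY; rewrite setTI.
  (* Where the cell index is [k], the function depends on [t] alone, so preimages are countable
     unions of rectangles. *)
  have -> : fn n @^-1` Y = \bigcup_(k in [set: int])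
     ([set t | Y (f (t, r n k))] `*`
      ((fun z : mR R => n.+1%:R * z : R) @^-1` `[k%:~R, (k + 1)%:~R[)).
    apply/seteqP; split => [[t z] /= Yt|[t z] /= [k _ [/= Yt]]].
      exists (Num.floor (n.+1%:R * z)) => //; split => //=.
      by rewrite in_itv /= floor_itv.
    rewrite in_itv /= => kz; rewrite /fn /=.
    by rewrite (@floor_def _ _ k).
  apply: countable_bigcupT_measurable => [|k]; first exact: countableP.
  apply: measurableX.
    by rewrite -[X in measurable X]setTI; exact: mf.
  rewrite -[X in measurable X]setTI.
  have mz : measurable_fun [set: mR R] (fun z : mR R => n.+1%:R * z : R).
    by apply: measurable_realfun.continuous_measurable_fun; exact: mulrl_continuous.
  exact: mz.
- move=> [t z] _; rewrite /fn /=.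
  have rz : (r n (Num.floor (n.+1%:R * (z : R)))) @[n --> \oo] --> (z : R).
    apply/cvgrPdist_lt => e e0; near=> n.
    have /andP[] := floor_itv (n.+1%:R * z); rewrite /r.
    set k := Num.floor _ => k1 k2.
    have n0 : (0 : R) < n.+1%:R by [].
    have -> : z - k%:~R / n.+1%:R = (n.+1%:R * z - k%:~R) / n.+1%:R by field.
    rewrite ger0_norm; last by rewrite divr_ge0 // subr_ge0.
    apply: (@le_lt_trans _ _ (n.+1%:R^-1)).
      by rewrite ler_pdivrMr // mulVf // lerBlDl; rewrite intrD in k2; exact: ltW.
    by near: n; exact: near_infty_natSinv_lt (PosNum e0).
  exact: (@cvg_comp _ _ _ _ (fun y : R => f (t, y)) _ _ _ rz (cf t z)).
Unshelve. all: end_near. Qed.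

(** * Integrable product weights on R^3 *)

Section Decay.
Variable R : realType.
Local Notation L := (@lebesgue_measure R).

Lemma integrable_oneDsqrV :
  L.-integrable setT (EFin \o (fun t : R => (oneDsqr t)^-1)).
Proof.
have cV : continuous (fun t : R => (oneDsqr t)^-1) by exact: continuous_oneDsqrV.
apply/integrableP; split.
  by apply/measurable_EFinP; exact: measurable_realfun.continuous_measurable_fun.
under eq_integral do rewrite /= ger0_norm ?invr_ge0 //.
rewrite ge0_symfun_integralT //.
- by rewrite -set_itvcy // integral0y_oneDsqr -EFinM ltry.
- by move=> x /=; rewrite /oneDsqr sqrrN.
Qed.

Lemma integrable_tensor d1 d2 (T1 : measurableType d1) (T2 : measurableType d2)
    (m1 : {sigma_finite_measure set T1 -> \bar R})
    (m2 : {sigma_finite_measure set T2 -> \bar R}) (f : T1 -> R) (g : T2 -> R) :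
  m1.-integrable setT (EFin \o f) -> m2.-integrable setT (EFin \o g) ->
  (m1 \x m2)%E.-integrable setT (EFin \o (fun p => f p.1 * g p.2)).
Proof.
move=> fi gi.
have mf := (measurable_EFinP _ _).1 (measurable_int _ fi).
have mg := (measurable_EFinP _ _).1 (measurable_int _ gi).
apply/integrable12ltyP.
  apply/measurable_EFinP; apply: measurable_funM.
    exact: measurableT_comp mf measurable_fst.
  exact: measurableT_comp mg measurable_snd.
have /integrableP[_ gfin] := gi.
have /integrableP[mf' ffin] := fi.
have gE : (\int[m2]_y `|(g y)%:E| = (fine (\int[m2]_y `|(g y)%:E|))%:E)%E.
  by rewrite fineK // ge0_fin_numE // integral_ge0.
under eq_integral => x _.
  under eq_integral do rewrite /= normrM EFinM.
  rewrite ge0_integralZl //; last first.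
    by apply/measurable_EFinP; exact: measurableT_comp.
  rewrite gE muleC; over.
set c := fine _.
have c0 : (0 <= c%:E)%E by rewrite lee_fin fine_ge0 // integral_ge0.
rewrite (@ge0_integralZl _ _ _ m1 setT measurableT _ _ c%:E) //.
  exact: lte_mul_pinfty.
by apply/measurable_EFinP; exact: measurableT_comp.
Qed.

(* [HB.pack] is needed because the library's canonical sigma-finite structure of
   a product is shadowed by that of products of subprobabilities. *)
Definition sigma_finite_prod d1 d2 (T1 : measurableType d1) (T2 : measurableType d2)
    (m1 : {sigma_finite_measure set T1 -> \bar R})
    (m2 : {sigma_finite_measure set T2 -> \bar R}) :
    {sigma_finite_measure set (T1 * T2)%type -> \bar R} :=
  HB.pack_for {sigma_finite_measure set (T1 * T2)%type -> \bar R} (m1 \x m2)%E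
    (lebesgue_integral_fubini.measure_function_Measure_isSigmaFinite__to__measure_function_isSFinite m1 m2)
    (lebesgue_integral_fubini.measure_function_Measure_isSigmaFinite__to__measure_function_isSigmaFinite m1 m2).

Definition leb2 : {sigma_finite_measure set (mR R * mR R)%type -> \bar R} :=
  sigma_finite_prod L L.

(** The measure [leb3], now with the sigma-finite structure that Tonelli's theorem asks for. *)
Definition sleb3 : {sigma_finite_measure set (mR R * mR R * mR R)%type -> \bar R} :=
  sigma_finite_prod leb2 L.

(** A product of one-variable weights: its reciprocal is integrable by tensorization, and its
    factors can be gained one coordinate at a time, by differentiating twice. *)
Definition poly3 (x : R * R * R) : R := oneDsqr x.1.1 * oneDsqr x.1.2 * oneDsqr x.2.

Lemma poly3_gt0 x : 0 < poly3 x.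
Proof. by rewrite /poly3 !mulr_gt0. Qed.

Lemma integrable_poly3V : (leb3 R).-integrable setT (EFin \o (fun x => (poly3 x)^-1)).
Proof.
have h := integrable_oneDsqrV.
have h2 : leb2.-integrable setT _ := integrable_tensor h h.
have := integrable_tensor h2 h.
apply: eq_integrable => // x _ /=.
by rewrite /poly3 !invfM.
Qed.

(** Each of the three factors is at most <x>^2. *)
Lemma poly3_le_japanese x : poly3 x <= japanese x ^+ 6.
Proof.
rewrite (exprM _ 2 3) sqr_sqrtr; last first.
  by rewrite /dot3 addr_ge0 // ?addr_ge0 // -expr2 sqr_ge0.
have le3 (a b c : R) : 0 <= a -> 0 <= b -> 0 <= c ->
    (1 + a) * (1 + b) * (1 + c) <= (1 + (a + b + c)) ^+ 3.
  move=> a0 b0 c0; rewrite exprS exprS expr1 mulrA.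
  by rewrite !ler_pM ?mulr_ge0 ?addr_ge0 //; lra.
by rewrite /poly3 /oneDsqr /dot3 -!expr2 le3 ?sqr_ge0.
Qed.

Lemma integrable_decay (g : R * R * R -> R) (M : R) :
  measurable_fun setT (g : mR R * mR R * mR R -> R) ->
  (forall x, poly3 x * `|g x| <= M) ->
  (leb3 R).-integrable setT (EFin \o g).
Proof.
move=> mg gM.
have := @integrableZl _ _ _ (leb3 R) setT measurableT M _ integrable_poly3V.
apply: le_integrable => //; first exact/measurable_EFinP.
move=> x _ /=; rewrite lee_fin.
apply: le_trans (ler_norm _); rewrite ler_pdivlMr ?poly3_gt0 // mulrC; exact: gM.
Qed.

End Decay.

(** * Integrals of derivatives over the line *)

Section VanishingIntegral.
Variable R : realType.
Local Notation L := (@lebesgue_measure R).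

Lemma derivable1_continuous (F f : R -> R) :
  (forall t : R, is_derive t 1 F (f t)) -> continuous F.
Proof.
by move=> dF t; apply/differentiable_continuous/derivable1_diffP; have [] := dF t.
Qed.

Lemma integrable_oneDsqr_decay (C : R) (f : R -> R) : continuous f ->
  (forall t, oneDsqr t * `|f t| <= C) -> L.-integrable setT (EFin \o f).
Proof.
move=> cf fC.
have := @integrableZl _ _ _ L setT measurableT C _ (integrable_oneDsqrV R).
apply: le_integrable => //.
  by apply/measurable_EFinP; exact: measurable_realfun.continuous_measurable_fun.
move=> x _ /=; rewrite lee_fin; apply: le_trans (ler_norm _).
by rewrite ler_pdivlMr // mulrC; exact: fC.
Qed.

(** On [-n-1, n+1] the fundamental theorem of calculus leaves F(n+1) - F(-n-1), which tends to 0 by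
    the decay of [F]; dominated convergence identifies the limit with the full integral. *)
Lemma integral_derive_eq0 (F f : R -> R) (C : R) :
  (forall t : R, is_derive t 1 F (f t)) -> continuous f ->
  (forall t, oneDsqr t * `|F t| <= C) -> (forall t, oneDsqr t * `|f t| <= C) ->
  (\int[L]_t (f t)%:E = 0)%E.
Proof.
move=> dF cf FC fC.
have cF := derivable1_continuous dF.
have mf : measurable_fun setT f by exact: measurable_realfun.continuous_measurable_fun.
have fi := integrable_oneDsqr_decay cf fC.
pose I (n : nat) : set R := `[- n.+1%:R, n.+1%:R]%classic.
pose fn (n : nat) : R -> \bar R := (EFin \o f) \_ (I n).
have mI n : measurable (I n) by exact: measurable_itv.
have [_ _] : [/\ L.-integrable setT (EFin \o f),
    [sequence \int[L]_(x in setT) (`|fn n x - (EFin \o f) x|)]_n @ \oo --> 0 &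
    [sequence \int[L]_(x in setT) (fn n x)]_n @ \oo --> \int[L]_(x in setT) ((EFin \o f) x)]%E.
  apply: (@dominated_convergence _ _ _ L setT measurableT fn (EFin \o f)
    (abse \o (EFin \o f))) => //.
  - move=> n; apply/(measurable_restrictT _ (mI n)).
    by apply: measurable_funTS; exact/measurable_EFinP.
  - exact/measurable_EFinP.
  - apply/aeW => t _; apply: cvg_near_cst.
    exists (Num.trunc `|t|).+1 => // n /= tn; rewrite /fn patchE mem_set //=.
    have : `|t| <= n.+1%:R.
      apply: le_trans (ltW (truncnS_gt _)) _.
      by rewrite ler_nat (leq_trans tn).
    by rewrite ler_norml /I /= in_itv /=.
  - exact: integrable_abse.
  - apply/aeW => t n _; rewrite /fn patchE /=; case: ifPn => // _.
    by rewrite /point /= normr0 lee_fin.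
have FnE n : (\int[L]_x fn n x = (F n.+1%:R - F (- n.+1%:R))%:E)%E.
  rewrite -integral_mkcond (@continuous_FTC2 _ f F) //.
  - by rewrite gtrN.
  - exact: continuous_subspaceT.
  - split; first by move=> x _; have [] := dF x.
      by apply: cvg_at_right_filter; exact: cF.
    by apply: cvg_at_left_filter; exact: cF.
  - by move=> x _; rewrite derive1E; have [] := dF x.
have Fcvg : (fun n : nat => (F n.+1%:R - F (- n.+1%:R))%:E : \bar R) @ \oo --> 0%E.
  apply: cvg_EFin; first exact: nearW.
  apply/cvgrPdist_lt => e e0.
  have C0 : 0 <= C by apply: le_trans (FC 0); rewrite mulr_ge0.
  have CC : 0 < C + C + 1 by rewrite ltr_wpDl // addr_ge0.
  near=> n.
  (* At distance n+1 >= 1 from the origin, 1/(1 + t^2) is at most 1/(n+1). *)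
  have Fle (t : R) : `|t| = n.+1%:R -> `|F t| <= C * (n.+1%:R)^-1.
    move=> tn; have := FC t; rewrite mulrC -ler_pdivlMr // => /le_trans; apply.
    rewrite ler_wpM2l // lef_pV2 ?posrE //.
    rewrite /oneDsqr -real_normK ?num_real // tn.
    have : (1 : R) <= n.+1%:R by rewrite ler1n.
    by move=> ?; nra.
  rewrite /= sub0r normrN; apply: (@le_lt_trans _ _ (C * n.+1%:R^-1 + C * n.+1%:R^-1)).
    apply: le_trans (ler_normB _ _) _.
    by apply: lerD; apply: Fle; rewrite ?normrN ger0_norm.
  apply: (@lt_trans _ _ ((C + C + 1) * n.+1%:R^-1)).
    by rewrite -mulrDl ltr_pM2r ?ltrDl.
  rewrite mulrC -ltr_pdivlMr //.
  near: n; exact: near_infty_natSinv_lt (PosNum (divr_gt0 e0 CC)).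
move=> /= ; rewrite (_ : (fun n => _) = fun n => (F n.+1%:R - F (- n.+1%:R))%:E); last first.
  by apply/funext => n; exact: FnE.
by move=> h; apply: (cvg_unique _ h Fcvg); exact: ereal_hausdorff.
Unshelve. all: end_near. Qed.
End VanishingIntegral.

(** * Lines parallel to the axes, and Fubini *)

Section Coordinates.
Variable R : realType.
Local Notation L := (@lebesgue_measure R).
Implicit Types x : R * R * R.

Definition coord3 (j : 'I_3) x : R :=
  if j == 0 :> nat then x.1.1 else if j == 1%N :> nat then x.1.2 else x.2.

Definition upd3 (j : 'I_3) x (t : R) : R * R * R :=
  if j == 0 :> nat then (t, x.1.2, x.2)
  else if j == 1%N :> nat then (x.1.1, t, x.2) else (x.1.1, x.1.2, t).

Lemma coord3_upd3 j x t : coord3 j (upd3 j x t) = t.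
Proof. by case: j => -[|[|[|//]]]. Qed.

Lemma upd3_coord3 j x : upd3 j x (coord3 j x) = x.
Proof. by case: x j => -[a b] c [[|[|[|//]]]]. Qed.

Lemma upd3_shift j x t h : h *: basis3 R j + upd3 j x t = upd3 j x (h *: 1 + t).
Proof.
case: j => -[|[|[|//]]] i; rewrite /upd3 /basis3 /=;
  rewrite [LHS]surjective_pairing [X in (X, _)]surjective_pairing;
  by congr (_, _, _); rewrite /= /GRing.scale /= ?mulr0 ?add0r ?mulr1.
Qed.

(** The two difference quotients coincide, so one-variable calculus on axis-parallel lines applies
    to the partial derivatives. *)
Lemma is_derive_upd3 (H : R * R * R -> R) j x t d :
  is_derive (upd3 j x t) (basis3 R j) H d <-> is_derive t 1 (H \o upd3 j x) d.
Proof.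
have E : (fun h : R => h^-1 *: ((H \o shift (upd3 j x t)) (h *: basis3 R j) - H (upd3 j x t))) =
    (fun h : R => h^-1 *: (((H \o upd3 j x) \o shift t) (h *: 1) - (H \o upd3 j x) t)).
  by apply/funext => h /=; rewrite upd3_shift.
by split=> -[d1 d2]; split; move: d1 d2; rewrite /derivable /derive E.
Qed.

Lemma oneDsqr_le_poly3 j x : oneDsqr (coord3 j x) <= poly3 x.
Proof.
have l3 (a b c : R) : 1 <= a -> 1 <= b -> 1 <= c ->
    [/\ a <= a * b * c, b <= a * b * c & c <= a * b * c].
  move=> a1 b1 c1.
  have [a0 b0 c0] : [/\ 0 <= a, 0 <= b & 0 <= c] by split; apply: le_trans ler01 _.
  have ab : 1 <= a * b by rewrite mulr_ege1.
  split; last by rewrite ler_peMl.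
    by rewrite -mulrA ler_peMr // mulr_ege1.
  by rewrite mulrAC ler_peMl // mulr_ege1.
have [] := l3 _ _ _ (oneDsqr_ge1 x.1.1) (oneDsqr_ge1 x.1.2) (oneDsqr_ge1 x.2).
by case: j => -[|[|[|//]]].
Qed.

Lemma integrable_section_decay (h : R * R * R -> R) (C z : R) :
  measurable_fun setT (h : mR R * mR R * mR R -> R) ->
  (forall x, poly3 x * `|h x| <= C) ->
  (L \x L)%E.-integrable setT (EFin \o (fun p => h (p, z))).
Proof.
move=> mh hC.
have iV := integrable_oneDsqrV R.
have := @integrableZl _ _ _ _ _ measurableT C _ (integrable_tensor iV iV).
apply: le_integrable => //.
  apply/measurable_EFinP.
  apply: (measurableT_comp mh (_ : measurable_fun setT (fun p : mR R * mR R => (p, z : mR R)))).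
  exact: measurable_fun_pair.
move=> [x y] _ /=; rewrite lee_fin; apply: le_trans (ler_norm _).
rewrite -invfM ler_pdivlMr ?mulr_gt0 // mulrC; apply: le_trans (hC (x, y, z)).
by rewrite ler_wpM2r // /poly3 /= ler_peMr // ?oneDsqr_ge1 // mulr_ge0.
Qed.

(** Fubini with the [j]-th variable innermost: every inner integral is that of a derivative along a
    line, and vanishes. *)
Lemma integral_partial_eq0 (j : 'I_3) (H h : R * R * R -> R) (C : R) :
  (forall x, is_derive x (basis3 R j) H (h x)) ->
  (forall x, continuous (h \o upd3 j x)) ->
  measurable_fun setT (h : mR R * mR R * mR R -> R) ->
  (forall x, poly3 x * `|H x| <= C) -> (forall x, poly3 x * `|h x| <= C) ->
  (\int[leb3 R]_x (h x)%:E = 0)%E.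
Proof.
move=> dH ch mh HC hC.
have line x : (\int[L]_t (h (upd3 j x t))%:E = 0)%E.
  apply: (@integral_derive_eq0 _ (H \o upd3 j x) _ C) => [t||t|t].
  - by apply/is_derive_upd3; exact: dH.
  - exact: ch.
  - apply: le_trans (HC (upd3 j x t)); rewrite ler_wpM2r //.
    by rewrite -{1}[t](coord3_upd3 j x) oneDsqr_le_poly3.
  - apply: le_trans (hC (upd3 j x t)); rewrite ler_wpM2r //.
    by rewrite -{1}[t](coord3_upd3 j x) oneDsqr_le_poly3.
have ih := integrable_decay mh hC.
have ih3 : (leb2 R \x L)%E.-integrable setT (EFin \o h) by exact: ih.
rewrite (_ : leb3 R = (leb2 R \x L)%E :> {measure set _ -> \bar R}) //.
(* The measure is nested as ((x, y), z). The third variable is reached by one use of Fubini; the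
   first two need another one inside the slice of fixed z. *)
case: j line {dH ch} => -[|[|[|//]]] i line.
- rewrite -(integral21_prod_meas1 ih3); apply: integral0_eq => z _; rewrite /fubini_G.
  have iz : (L \x L)%E.-integrable setT (EFin \o (fun p => h (p, z))).
    exact: integrable_section_decay mh hC.
  rewrite -(integral21_prod_meas1 iz); apply: integral0_eq => y _; rewrite /fubini_G /=.
  exact: (line (0, y, z)).
- rewrite -(integral21_prod_meas1 ih3); apply: integral0_eq => z _; rewrite /fubini_G.
  have iz : (L \x L)%E.-integrable setT (EFin \o (fun p => h (p, z))).
    exact: integrable_section_decay mh hC.
  rewrite -(integral12_prod_meas1 iz); apply: integral0_eq => y _; rewrite /fubini_F /=.
  exact: (line (y, 0, z)).
- rewrite -(integral12_prod_meas1 ih3); apply: integral0_eq => z _; rewrite /fubini_F /=.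
  case: z => a b; exact: (line (a, b, 0)).
Qed.

End Coordinates.

(** * Fourier transform of Schwartz functions *)

Section RealSchwartz.
Variable R : realType.
Implicit Types (g h : R * R * R -> R) (x xi : R * R * R).

Lemma schwartz_real_partial j g :
  schwartz_real g -> schwartz_real ('D_(basis3 R j) g).
Proof.
(* [partials] folds from the right, so the derivative taken first stands last in the list. *)
move=> Sg s; have := Sg (rcons s j).
by rewrite /partials foldr_rcons.
Qed.

Lemma schwartz_real_derive j g x : schwartz_real g ->
  is_derive x (basis3 R j) g ('D_(basis3 R j) g x).
Proof. by move=> Sg; have [d _] := Sg [::]; split. Qed.

Lemma schwartz_real_bound g : schwartz_real g ->
  exists C : R, forall x, poly3 x * `|g x| <= C.
Proof.
move=> Sg; have [_ /(_ 6%N) [C gC]] := Sg [::].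
exists C => x; apply: le_trans (gC x).
by rewrite ler_wpM2r // poly3_le_japanese.
Qed.

Lemma schwartz_real_continuous j g x : schwartz_real g -> continuous (g \o upd3 j x).
Proof.
move=> Sg; apply: (@derivable1_continuous _ _ (fun t => 'D_(basis3 R j) g (upd3 j x t))).
by move=> t; apply/is_derive_upd3; exact: schwartz_real_derive.
Qed.

(** Derivatives along the axes give continuity in each coordinate separately; the criterion for such
    functions is applied to the third coordinate, then to the second. *)
Lemma schwartz_real_measurable g : schwartz_real g ->
  measurable_fun setT (g : mR R * mR R * mR R -> R).
Proof.
move=> Sg.
have i0 : (0 < 3)%N by []. have i1 : (1 < 3)%N by []. have i2 : (2 < 3)%N by [].
apply: measurable_separately_continuous => [z|[x y]]; last first.
  exact: (@schwartz_real_continuous (Ordinal i2) g (x, y, 0) Sg).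
apply: (@measurable_separately_continuous _ _ R (fun p => g (p, z))) => [y|x]; last first.
  exact: (@schwartz_real_continuous (Ordinal i1) g (x, 0, z) Sg).
apply: measurable_realfun.continuous_measurable_fun.
exact: (@schwartz_real_continuous (Ordinal i0) g (0, y, z) Sg).
Qed.

Lemma schwartz_real_integrable g : schwartz_real g ->
  (leb3 R).-integrable setT (EFin \o g).
Proof.
move=> Sg; have [C gC] := schwartz_real_bound Sg.
exact: integrable_decay (schwartz_real_measurable Sg) gC.
Qed.

Lemma partials_comb s g h (a b : R) : schwartz_real g -> schwartz_real h ->
  partials s (fun x => a * g x + b * h x) =
  (fun x => a * partials s g x + b * partials s h x).
Proof.
move=> Sg Sh; elim: s => [//|j s IH] /=; rewrite IH; apply/funext => x.
have [dg _] := Sg s; have [dh _] := Sh s.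
rewrite (deriveD (f := a *: partials s g) (g := b *: partials s h)); last 2 first.
- by apply: derivableZ.
- by apply: derivableZ.
by rewrite !deriveZ.
Qed.

Lemma schwartz_real_comb g h (a b : R) : schwartz_real g -> schwartz_real h ->
  schwartz_real (fun x => a * g x + b * h x).
Proof.
move=> Sg Sh s; rewrite partials_comb //; have [dg bg] := Sg s; have [dh bh] := Sh s.
split=> [x j|N].
  apply: (derivableD (f := a *: partials s g) (g := b *: partials s h)).
    by apply: derivableZ.
  by apply: derivableZ.
have [Mg gM] := bg N; have [Mh hM] := bh N.
exists (`|a| * Mg + `|b| * Mh) => x.
have j0 : 0 <= japanese x ^+ N by rewrite exprn_ge0 // sqrtr_ge0.
apply: (@le_trans _ _ (japanese x ^+ N * (`|a| * `|partials s g x| + `|b| * `|partials s h x|))).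
  by rewrite ler_wpM2l // -!normrM ler_normD.
rewrite mulrDr mulrCA (mulrCA _ `|b|).
by apply: lerD; apply: ler_wpM2l.
Qed.

Lemma dot3_upd3 j x t xi :
  dot3 (upd3 j x t) xi = dot3 (upd3 j x 0) xi + t * coord3 j xi.
Proof. by case: j => -[|[|[|//]]] i; rewrite /dot3 /upd3 /coord3 /=; ring. Qed.

Lemma measurable_dot3 xi :
  measurable_fun setT ((fun x => dot3 x xi) : mR R * mR R * mR R -> R).
Proof.
have m1 : measurable_fun setT (fun x : mR R * mR R * mR R => x.1.1 : mR R).
  exact: (measurableT_comp measurable_fst measurable_fst).
have m2 : measurable_fun setT (fun x : mR R * mR R * mR R => x.1.2 : mR R).
  exact: (measurableT_comp measurable_snd measurable_fst).
have m3 : measurable_fun setT (fun x : mR R * mR R * mR R => x.2 : mR R).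
  exact: measurable_snd.
by rewrite /dot3; apply: measurable_funD; first apply: measurable_funD;
  apply: measurable_funM.
Qed.

Lemma measurable_joint_dot3 : measurable_fun setT
  ((fun p => dot3 p.1 p.2) : (mR R * mR R * mR R) * (mR R * mR R * mR R) -> R).
Proof.
have f1 := @measurable_fst _ _ (mR R * mR R * mR R)%type (mR R * mR R * mR R)%type.
have f2 := @measurable_snd _ _ (mR R * mR R * mR R)%type (mR R * mR R * mR R)%type.
have m1 : measurable_fun setT (fun x : mR R * mR R * mR R => x.1.1 : mR R).
  exact: (measurableT_comp measurable_fst measurable_fst).
have m2 : measurable_fun setT (fun x : mR R * mR R * mR R => x.1.2 : mR R).
  exact: (measurableT_comp measurable_snd measurable_fst).
have m3 : measurable_fun setT (fun x : mR R * mR R * mR R => x.2 : mR R).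
  exact: measurable_snd.
by rewrite /dot3; apply: measurable_funD; first apply: measurable_funD;
  apply: measurable_funM; first [exact: measurableT_comp m1 f1 | exact: measurableT_comp m1 f2
  | exact: measurableT_comp m2 f1 | exact: measurableT_comp m2 f2
  | exact: measurableT_comp m3 f1 | exact: measurableT_comp m3 f2].
Qed.

End RealSchwartz.

(** * Cosine transforms and integration by parts *)

Section TrigTransform.
Variable R : realType.
Implicit Types (g h : R * R * R -> R) (x xi : R * R * R).
Local Notation mR3 := (mR R * mR R * mR R)%type.

(* The phase makes one transform serve for both [cos] and
   [sin t = cos (t - pi / 2)]. *)
Definition trig (theta : R) g xi : R :=
  \int[leb3 R]_x (cos (dot3 x xi + theta) * g x).

Lemma measurable_cos_dot3 theta xi :
  measurable_fun setT ((fun x => cos (dot3 x xi + theta)) : mR3 -> R).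
Proof.
apply: (measurableT_comp (measurable_realfun.continuous_measurable_fun (@continuous_cos R))).
exact: measurable_funD (measurable_dot3 xi) (measurable_cst theta).
Qed.

Lemma trig_integrable theta g xi : (leb3 R).-integrable setT (EFin \o g) ->
  (leb3 R).-integrable setT (EFin \o (fun x => cos (dot3 x xi + theta) * g x)).
Proof.
move=> gi; have mg := (measurable_EFinP _ _).1 (measurable_int _ gi).
apply: le_integrable gi => //.
  apply/measurable_EFinP; apply: measurable_funM => //; exact: measurable_cos_dot3.
move=> x _ /=; rewrite lee_fin normrM ler_piMl //; exact: cos_max.
Qed.

Lemma trig_comb theta g h (a b : R) xi :
  (leb3 R).-integrable setT (EFin \o g) -> (leb3 R).-integrable setT (EFin \o h) ->
  trig theta (fun x => a * g x + b * h x) xi = a * trig theta g xi + b * trig theta h xi.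
Proof.
move=> gi hi; have tg := trig_integrable theta xi gi; have th := trig_integrable theta xi hi.
rewrite /trig -!RintegralZl // -RintegralD //; last 2 first.
- exact: (@integrableZl _ _ _ (leb3 R) setT measurableT a _ tg).
- exact: (@integrableZl _ _ _ (leb3 R) setT measurableT b _ th).
by apply: eq_Rintegral => x _; ring.
Qed.

Lemma trig_le theta g xi : (leb3 R).-integrable setT (EFin \o g) ->
  `|trig theta g xi| <= \int[leb3 R]_x `|g x|.
Proof.
move=> gi; have tg := trig_integrable theta xi gi.
apply: le_trans (le_normr_Rintegral measurableT tg) _.
apply: le_Rintegral => //; try exact: integrable_norm.
by move=> x _; rewrite normrM ler_piMl // cos_max.
Qed.

(** Tonelli gives measurability for the positive and the negative part; subtraction of extended
    reals and [fine] preserve it. *)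
Lemma measurable_Rintegral_param d1 d2 (T1 : measurableType d1) (T2 : measurableType d2)
    (m : {sigma_finite_measure set T2 -> \bar R}) (f : T1 * T2 -> R) :
  measurable_fun setT f ->
  measurable_fun setT (fun x : T1 => \int[m]_y f (x, y)).
Proof.
move=> mf; apply: (measurableT_comp (fine_measurable measurableT)).
have mfE : measurable_fun setT (EFin \o f) by exact/measurable_EFinP.
have := emeasurable_funB
  (measurable_fun_fubini_tonelli_F (m2 := m) _ (measurable_funepos mfE) (funepos_ge0 _))
  (measurable_fun_fubini_tonelli_F (m2 := m) _ (measurable_funeneg mfE) (funeneg_ge0 _)).
apply: eq_measurable_fun => x _.
rewrite [RHS]integralE; congr (_ - _)%E; apply: eq_integral => y _.
  by rewrite !funeposE.
by rewrite !funenegE.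
Qed.

Lemma measurable_trig theta g : measurable_fun setT (g : mR3 -> R) ->
  measurable_fun setT (trig theta g : mR3 -> R).
Proof.
move=> mg.
apply: (@measurable_Rintegral_param _ _ mR3 mR3 (sleb3 R)
  (fun p => cos (dot3 p.2 p.1 + theta) * g p.2)).
apply: measurable_funM; last exact: (measurableT_comp mg measurable_snd).
apply: (measurableT_comp (measurable_realfun.continuous_measurable_fun (@continuous_cos R))).
apply: measurable_funD (measurable_cst theta).
apply: eq_measurable_fun (@measurable_joint_dot3 R) => p _.
by rewrite /dot3 /=; ring.
Qed.

(** Integration by parts: the integral of the [j]-th derivative of cos(x.xi + theta) g vanishes, and
    the sine that appears is a cosine with phase lowered by pi/2. *)
Lemma trig_partial theta j g xi : schwartz_real g ->
  trig theta ('D_(basis3 R j) g) xi = coord3 j xi * trig (theta - pi / 2) g xi.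
Proof.
move=> Sg; have Sdg := schwartz_real_partial j Sg.
set dg := 'D_(basis3 R j) g in Sdg *.
pose H x := cos (dot3 x xi + theta) * g x.
pose k x := cos (dot3 x xi + theta) * dg x
          + - coord3 j xi * (cos (dot3 x xi + (theta - pi / 2)) * g x).
have dH x : is_derive x (basis3 R j) H (k x).
  rewrite -[x](upd3_coord3 j); apply/is_derive_upd3; set t := coord3 j x.
  pose c := dot3 (upd3 j x 0) xi + theta.
  have d1 : is_derive t 1 (fun t : R => c + t * coord3 j xi) (coord3 j xi).
    have h1 : is_derive t 1 ((fun t : R => c + t * coord3 j xi)) (0 + coord3 j xi *: 1).
      have -> : (fun t : R => c + t * coord3 j xi) = cst c + coord3 j xi *: id.
        by apply/funext => s; rewrite !fctE /GRing.scale /= mulrC.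
      by apply: is_deriveD.
    by apply: is_derive_eq h1 _; rewrite add0r /GRing.scale /= mulr1.
  have d2 := @is_derive1_comp _ cos (fun t : R => c + t * coord3 j xi) t _ _ (is_derive_cos _) d1.
  have d3 : is_derive t 1 (g \o upd3 j x) (dg (upd3 j x t)).
    by apply/is_derive_upd3; exact: schwartz_real_derive.
  have := is_deriveM d2 d3.
  have -> : (cos \o (fun t0 => c + t0 * coord3 j xi)) * (g \o upd3 j x) = H \o upd3 j x.
    apply/funext => s; rewrite !fctE /H (dot3_upd3 j x s).
    by congr (cos _ * _); rewrite /c; ring.
  move=> h; apply: is_derive_eq h _; rewrite /k /= addrA cosBpihalf (dot3_upd3 j x t) /GRing.scale /=.
  rewrite (_ : c + t * coord3 j xi = dot3 (upd3 j x 0) xi + t * coord3 j xi + theta).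
    by ring.
  by rewrite /c; ring.
have ck x : continuous (k \o upd3 j x).
  have cc th : continuous (fun t : R => cos (dot3 (upd3 j x t) xi + th)).
    move=> t; apply: (@continuous_comp _ _ _ (fun t => dot3 (upd3 j x t) xi + th) cos).
      apply: cvgD; last exact: cvg_cst.
      under eq_fun do rewrite dot3_upd3.
      rewrite /continuous_at dot3_upd3; apply: cvgD; first exact: cvg_cst.
      by apply: cvgMr_tmp; exact: cvg_id.
    exact: continuous_cos.
  have cg := schwartz_real_continuous (j := j) (x := x) Sg.
  have cdg := schwartz_real_continuous (j := j) (x := x) Sdg.
  move=> t; apply: cvgD; first by apply: cvgM; [exact: cc|exact: cdg].
  apply: cvgM; first exact: cvg_cst.
  by apply: cvgM; [exact: cc|exact: cg].
have mk : measurable_fun setT (k : mR3 -> R).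
  have mg := schwartz_real_measurable Sg; have mdg := schwartz_real_measurable Sdg.
  apply: measurable_funD; first by apply: measurable_funM => //; exact: measurable_cos_dot3.
  apply: measurable_funM => //; apply: measurable_funM => //; exact: measurable_cos_dot3.
have [Cg gC] := schwartz_real_bound Sg.
have [Cd dC] := schwartz_real_bound Sdg.
have cle (th y : R) x : `|cos (dot3 x xi + th) * y| <= `|y|.
  by rewrite normrM ler_piMl // cos_max.
have Cg0 : 0 <= Cg by apply: le_trans (gC 0); rewrite mulr_ge0 // ltW // poly3_gt0.
have Cd0 : 0 <= Cd by apply: le_trans (dC 0); rewrite mulr_ge0 // ltW // poly3_gt0.
(* [integral_partial_eq0] wants a single constant for [H] and for its derivative [k]; this one
   dominates both. *)
have HC x : poly3 x * `|H x| <= Cg + (Cd + `|coord3 j xi| * Cg).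
  apply: (@le_trans _ _ Cg); last by rewrite lerDl addr_ge0 // mulr_ge0.
  by apply: le_trans (gC x); rewrite ler_wpM2l ?(ltW (poly3_gt0 _)) ?cle.
have kC x : poly3 x * `|k x| <= Cg + (Cd + `|coord3 j xi| * Cg).
  apply: (@le_trans _ _ (Cd + `|coord3 j xi| * Cg)); last by rewrite lerDr.
  apply: (@le_trans _ _ (poly3 x * (`|dg x| + `|coord3 j xi| * `|g x|))).
    rewrite ler_wpM2l ?(ltW (poly3_gt0 _)) //.
    apply: le_trans (ler_normD _ _) _; apply: lerD; first exact: cle.
    by rewrite normrM normrN ler_wpM2l ?cle.
  rewrite mulrDr mulrCA; apply: lerD => //; exact: ler_wpM2l.
have int0 := integral_partial_eq0 dH ck mk HC kC.
have : \int[leb3 R]_x k x = 0 by rewrite /Rintegral int0.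
have gi := schwartz_real_integrable Sg; have dgi := schwartz_real_integrable Sdg.
have tg := trig_integrable (theta - pi / 2) xi gi.
rewrite /k RintegralD //; last 2 first.
- exact: trig_integrable.
- exact: (@integrableZl _ _ _ (leb3 R) setT measurableT (- coord3 j xi) _ tg).
by rewrite RintegralZl // mulNr => /eqP; rewrite subr_eq0 => /eqP.
Qed.

(** Two derivatives lower the phase by pi in all, which reverses the sign of the cosine. *)
Lemma trig_partial2 theta j g xi : schwartz_real g ->
  trig theta ('D_(basis3 R j) ('D_(basis3 R j) g)) xi = - coord3 j xi ^+ 2 * trig theta g xi.
Proof.
move=> Sg; have Sdg := schwartz_real_partial j Sg.
rewrite !trig_partial // -addrA -opprD -splitr mulrA -expr2 mulNr -mulrN; congr (_ * _).
rewrite /trig -mulN1r -RintegralZl //; last exact/trig_integrable/schwartz_real_integrable.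
by apply: eq_Rintegral => x _; rewrite addrA cosB cospi sinpi; ring.
Qed.

End TrigTransform.

(** * Fourier transform and Bessel potential: linearity, measurability, decay *)

Section Fourier.
Variable R : realType.
Local Open Scope complex_scope.
Implicit Types (x xi : R * R * R) (u v : R * R * R -> R[i]).
Local Notation mR3 := (mR R * mR R * mR R)%type.

(** The factor 1 + xi_j^2 corresponds to 1 - D_j^2, so each further factor costs two derivatives:
    the induction hypothesis is used for [g] and for its second [j]-th derivative. *)
Lemma trig_prod_decay theta (s : seq 'I_3) (g : R * R * R -> R) : schwartz_real g ->
  exists C : R, forall xi,
    (\prod_(j <- s) oneDsqr (coord3 j xi)) * `|trig theta g xi| <= C.
Proof.
elim: s g => [|j s IH] g Sg.
  exists (\int[leb3 R]_x `|g x|) => xi; rewrite big_nil mul1r.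
  exact/trig_le/schwartz_real_integrable.
have [C1 h1] := IH g Sg.
have [C2 h2] := IH _ (schwartz_real_partial j (schwartz_real_partial j Sg)).
exists (C1 + C2) => xi; rewrite big_cons.
apply: le_trans (lerD (h1 xi) (h2 xi)); rewrite trig_partial2 //.
set P := \prod_(i <- s) _; rewrite /oneDsqr.
rewrite normrM normrN (ger0_norm (sqr_ge0 _)).
by rewrite le_eqVlt; apply/orP; left; apply/eqP; ring.
Qed.

Lemma trig_decay theta (g : R * R * R -> R) : schwartz_real g ->
  exists C : R, forall xi, poly3 xi * `|trig theta g xi| <= C.
Proof.
move=> Sg.
have i0 : (0 < 3)%N by []. have i1 : (1 < 3)%N by []. have i2 : (2 < 3)%N by [].
have [C h] := trig_prod_decay theta [:: Ordinal i0; Ordinal i1; Ordinal i2] Sg.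
by exists C => xi; have := h xi; rewrite !big_cons big_nil /poly3 /coord3 /= mulr1 mulrA.
Qed.

Definition cintegrable u :=
  (leb3 R).-integrable setT (EFin \o (fun x => complex.Re (u x))) /\
  (leb3 R).-integrable setT (EFin \o (fun x => complex.Im (u x))).

Definition cmeasurable u :=
  measurable_fun setT ((fun x => complex.Re (u x)) : mR3 -> R) /\
  measurable_fun setT ((fun x => complex.Im (u x)) : mR3 -> R).

Lemma cintegrable_measurable u : cintegrable u -> cmeasurable u.
Proof.
by move=> [ru iu]; split;
  [exact: (measurable_EFinP _ _).1 (measurable_int _ ru)
  |exact: (measurable_EFinP _ _).1 (measurable_int _ iu)].
Qed.

Lemma schwartz_integrable u : schwartz u -> cintegrable u.
Proof. by move=> [ru iu]; split; exact: schwartz_real_integrable. Qed.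

Lemma schwartz_comb a u v : schwartz u -> schwartz v -> schwartz (a *: u + v).
Proof.
move=> [ru iu] [rv iv]; split.
  have := schwartz_real_comb 1 1 (schwartz_real_comb (complex.Re a) (- complex.Im a) ru iu) rv.
  congr schwartz_real; apply/funext => x; rewrite !fctE /GRing.scale /=.
  by case: a (u x) (v x) => [? ?] [? ?] [? ?] /=; ring.
have := schwartz_real_comb 1 1 (schwartz_real_comb (complex.Re a) (complex.Im a) iu ru) iv.
congr schwartz_real; apply/funext => x; rewrite !fctE /GRing.scale /=.
by case: a (u x) (v x) => [? ?] [? ?] [? ?] /=; ring.
Qed.

Definition fconst : R := (2 * pi) `^ (- (3 / 2)).

(** Expands exp(-it) = cos t - i sin t with sin t = cos(t - pi/2); integrability allows the
    splitting of the integrals. *)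
Lemma fourierE u xi : cintegrable u -> fourier u xi = fconst%:C *
  ((trig 0 (fun x => complex.Re (u x)) xi + trig (- (pi / 2)) (fun x => complex.Im (u x)) xi)
   +i* (trig 0 (fun x => complex.Im (u x)) xi - trig (- (pi / 2)) (fun x => complex.Re (u x)) xi)).
Proof.
move=> [ru iu]; rewrite /fourier; congr (_ * _).
have ti (g : R * R * R -> R) th := @trig_integrable R th g xi.
rewrite /Cintegral /trig -RintegralD ?ti // -RintegralB ?ti //.
congr (_ +i* _); apply: eq_Rintegral => x _;
  rewrite /expi addr0 cosBpihalf cosN sinN; case: (u x) => a b /=; ring.
Qed.

(** Through this reflection, linearity and measurability have to be proved for [fourier] only. *)
Lemma inv_fourierE u x : inv_fourier u x = fourier u (- x).
Proof.
rewrite /inv_fourier /fourier; congr (_ * Cintegral _); apply/funext => xi.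
by congr (expi _ * _); rewrite /dot3 /=; ring.
Qed.

Lemma fourier_linear a u v xi : cintegrable u -> cintegrable v ->
  fourier (a *: u + v) xi = a * fourier u xi + fourier v xi.
Proof.
move=> cu cv.
(* The coefficients 1 give the sum the shape [a * g + b * h] on which [trig_comb] rewrites,
   twice. *)
have ReE : (fun x => complex.Re ((a *: u + v) x)) =
    (fun x => 1 * (complex.Re a * complex.Re (u x) + - complex.Im a * complex.Im (u x)) +
              1 * complex.Re (v x)).
  apply/funext => x; rewrite !fctE /GRing.scale /=.
  by case: a (u x) (v x) => [? ?] [? ?] [? ?] /=; ring.
have ImE : (fun x => complex.Im ((a *: u + v) x)) =
    (fun x => 1 * (complex.Re a * complex.Im (u x) + complex.Im a * complex.Re (u x)) +
              1 * complex.Im (v x)).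
  apply/funext => x; rewrite !fctE /GRing.scale /=.
  by clear ReE; case: a (u x) (v x) => [? ?] [? ?] [? ?] /=; ring.
have combi (g h : R * R * R -> R) (c d : R) : (leb3 R).-integrable setT (EFin \o g) ->
    (leb3 R).-integrable setT (EFin \o h) ->
    (leb3 R).-integrable setT (EFin \o (fun x => c * g x + d * h x)).
  move=> gi hi.
  exact: (integrableD measurableT (@integrableZl _ _ _ (leb3 R) setT measurableT c _ gi)
     (@integrableZl _ _ _ (leb3 R) setT measurableT d _ hi)).
have [ru iu] := cu; have [rv iv] := cv.
rewrite (fourierE xi cu) (fourierE xi cv) fourierE; last first.
  by split; rewrite ?ReE ?ImE; do 2 (apply: (combi) => //).
rewrite ReE ImE !trig_comb //; try by apply: (combi).
by move: ReE ImE => _ _; case: a => a1 a2; apply/eqP;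
  rewrite eq_complex /=; apply/andP; split; apply/eqP; ring.
Qed.

Lemma fourier_measurable u : cintegrable u -> cmeasurable (fourier u).
Proof.
move=> cu; have [mr mi] := cintegrable_measurable cu.
have mt (g : R * R * R -> R) th := @measurable_trig R th g.
split.
  rewrite (_ : (fun _ => _) = fun xi => fconst * (trig 0 (fun x => complex.Re (u x)) xi +
      trig (- (pi / 2)) (fun x => complex.Im (u x)) xi)); last first.
    by apply/funext => xi; rewrite fourierE //= mul0r subr0.
  by apply: measurable_funM => //; apply: measurable_funD; exact: mt.
rewrite (_ : (fun _ => _) = fun xi => fconst * (trig 0 (fun x => complex.Im (u x)) xi -
    trig (- (pi / 2)) (fun x => complex.Re (u x)) xi)); last first.
  by apply/funext => xi; rewrite fourierE //= mul0r addr0.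
by apply: measurable_funM => //; apply: measurable_funB; exact: mt.
Qed.

Lemma measurable_japanese (k : R) :
  measurable_fun setT ((fun x => japanese x `^ k) : mR3 -> R).
Proof.
apply: (measurableT_comp (measurable_powR k)); rewrite /japanese.
have := measurable_joint_dot3 (R := R).
move=> md; have := measurableT_comp md
  (measurable_fun_pair (@measurable_id _ mR3 setT) (@measurable_id _ mR3 setT)).
move=> m; have ms : measurable_fun setT (@Num.sqrt R).
  by apply: measurable_realfun.continuous_measurable_fun => y; exact: sqrt_continuous.
apply: (measurableT_comp ms); apply: measurable_funD; first exact: measurable_cst.
exact: m.
Qed.

Lemma japanese_ge1 x : 1 <= japanese x.
Proof.
have d0 : 0 <= dot3 x x by rewrite /dot3 !addr_ge0 // -expr2 sqr_ge0.
rewrite -{1}sqrtr1 ler_sqrt ?lerDl //.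
by rewrite addr_ge0.
Qed.

Lemma fourier_decay u : schwartz u -> exists C : R, forall xi,
  poly3 xi * `|complex.Re (fourier u xi)| <= C /\
  poly3 xi * `|complex.Im (fourier u xi)| <= C.
Proof.
move=> Su; have cu := schwartz_integrable Su; have [Sr Si] := Su.
have f0 : 0 <= fconst by exact: powR_ge0.
have [Ca ha] := trig_decay 0 Sr. have [Cb hb] := trig_decay (- (pi / 2)) Si.
have [Cc hc] := trig_decay 0 Si. have [Cd hd] := trig_decay (- (pi / 2)) Sr.
have bnd (p q a b y : R) xi : poly3 xi * `|a| <= p -> poly3 xi * `|b| <= q ->
    `|y| <= `|a| + `|b| -> poly3 xi * `|fconst * y| <= fconst * (p + q).
  move=> ap bq yab; rewrite normrM (ger0_norm f0) mulrCA ler_wpM2l //.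
  apply: le_trans (lerD ap bq); rewrite -mulrDr ler_wpM2l //.
  exact/ltW/poly3_gt0.
exists (Num.max (fconst * (Ca + Cb)) (fconst * (Cc + Cd))) => xi.
rewrite fourierE //= !mul0r subr0 addr0 !le_max; split; apply/orP; [left|right].
  by apply: bnd (ha xi) (hb xi) _; exact: ler_normD.
by apply: bnd (hc xi) (hd xi) _; exact: ler_normB.
Qed.

(** For k <= 0 the multiplier lies between 0 and 1, so the decay of [fourier u] is inherited. *)
Lemma multiplier_integrable (k : R) u : k <= 0 -> schwartz u ->
  cintegrable (fun xi => (japanese xi `^ k)%:C * fourier u xi).
Proof.
move=> k0 Su; have [C uC] := fourier_decay Su.
have [mr mi] := fourier_measurable (schwartz_integrable Su).
have jk xi : 0 <= japanese xi `^ k <= 1.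
  rewrite powR_ge0 /= -(powRr0 (japanese xi)) ler_powR //; exact: japanese_ge1.
have bnd (y : R) xi : poly3 xi * `|y| <= C -> poly3 xi * `|japanese xi `^ k * y| <= C.
  move=> yC; apply: le_trans yC; rewrite ler_wpM2l ?(ltW (poly3_gt0 _)) //.
  by have /andP[j0 j1] := jk xi; rewrite normrM (ger0_norm j0) ler_piMl.
split.
  rewrite (_ : (fun _ => _) = fun xi => japanese xi `^ k * complex.Re (fourier u xi)).
    apply: (@integrable_decay R _ C) => [|xi]; last by apply: bnd; have [] := uC xi.
    exact: measurable_funM (measurable_japanese k) mr.
  by apply/funext => xi; case: (fourier u xi) => a b /=; rewrite mul0r subr0.
rewrite (_ : (fun _ => _) = fun xi => japanese xi `^ k * complex.Im (fourier u xi)).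
  apply: (@integrable_decay R _ C) => [|xi]; last by apply: bnd; have [] := uC xi.
  exact: measurable_funM (measurable_japanese k) mi.
by apply/funext => xi; case: (fourier u xi) => a b /=; rewrite mul0r addr0.
Qed.

Lemma bessel_linear (k : R) a u v x : k <= 0 -> schwartz u -> schwartz v ->
  bessel k (a *: u + v) x = a * bessel k u x + bessel k v x.
Proof.
move=> k0 Su Sv.
have iu := multiplier_integrable k0 Su; have iv := multiplier_integrable k0 Sv.
rewrite /bessel !inv_fourierE -(fourier_linear a (- x) iu iv).
have -> : (fun xi => (japanese xi `^ k)%:C * fourier (a *: u + v) xi) =
    a *: (fun xi => (japanese xi `^ k)%:C * fourier u xi) +
    (fun xi => (japanese xi `^ k)%:C * fourier v xi); last by [].
apply/funext => xi; rewrite !fctE.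
rewrite (fourier_linear a xi (schwartz_integrable Su) (schwartz_integrable Sv)).
by rewrite mulrDr mulrCA.
Qed.

Lemma measurable_opp3 : measurable_fun setT (-%R : mR3 -> mR3).
Proof.
have mo : measurable_fun setT (-%R : mR R -> mR R).
  exact: measurable_realfun.continuous_measurable_fun oppr_continuous.
apply: measurable_fun_pair; first apply: measurable_fun_pair.
- apply: (measurableT_comp mo); exact: (measurableT_comp measurable_fst measurable_fst).
- apply: (measurableT_comp mo); exact: (measurableT_comp measurable_snd measurable_fst).
- apply: (measurableT_comp mo); exact: measurable_snd.
Qed.

Lemma bessel_measurable (k : R) u : k <= 0 -> schwartz u -> cmeasurable (bessel k u).
Proof.
move=> k0 Su; have [mr mi] := fourier_measurable (multiplier_integrable k0 Su).
split; under eq_fun do rewrite /bessel inv_fourierE.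
  exact: (measurableT_comp mr measurable_opp3).
exact: (measurableT_comp mi measurable_opp3).
Qed.

End Fourier.

(** * Sobolev norms of nonpositive order *)

Section SobolevNorm.
Variables (R : realType) (k s : R).
Hypothesis k_le0 : k <= 0.
Local Open Scope complex_scope.
Local Notation mR3 := (mR R * mR R * mR R)%type.
Implicit Types u v : R * R * R -> R[i].

(** The integrand <x>^(2s) |(1 - Delta)^(k/2) u|^2, written with real squares so that relations
    between densities become polynomial identities. *)
Definition bessel_density u (x : R * R * R) : R :=
  (japanese x `^ s * complex.Re (bessel k u x)) ^+ 2 +
  (japanese x `^ s * complex.Im (bessel k u x)) ^+ 2.

Lemma bessel_density_measurable u : schwartz u -> measurable_fun setT (bessel_density u : mR3 -> R).
Proof.
move=> Su; have [mr mi] := bessel_measurable k_le0 Su.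
apply: measurable_funD; apply: measurable_funX; apply: measurable_funM => //;
  exact: measurable_japanese.
Qed.

Lemma bessel_density_ge0 u x : 0 <= bessel_density u x.
Proof. by rewrite addr_ge0 // sqr_ge0. Qed.

Variable H : sobolev k s.

Lemma sobolev_norm_sqr u : schwartz u ->
  ((complex.Re `|embed H u|) ^+ 2)%:E = (\int[leb3 R]_x (bessel_density u x)%:E)%E.
Proof.
move=> Su.
have := poweR_Lnorm (leb3 R) (fun x => (japanese x `^ s * ComplexField.Normc.normc (bessel k u x))%:E)
  (r := 2) (lt0r_neq0 (ltr0Sn _ 1)).
rewrite -/(sobolev_norm k s u) -(embed_norm H Su).
have n0 : 0 <= complex.Re `|embed H u|.
  by have := normr_ge0 (embed H u); rewrite lecE => /andP[].
rewrite poweR_EFin -powR_mulrn // => ->.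
apply: eq_integral => x _; congr EFin; rewrite -[LHS]/(`|_| `^ 2).
rewrite powR_mulrn // real_normK ?num_real // /bessel_density.
move: (bessel k u x) => [a b] /=.
by rewrite exprMn sqr_sqrtr ?addr_ge0 ?sqr_ge0 // !exprMn mulrDr.
Qed.

(** Finiteness comes from [embed_norm]: the integral is the square of a norm in the completion, so
    no decay of [bessel k u] is estimated. *)
Lemma bessel_density_integrable u : schwartz u ->
  (leb3 R).-integrable setT (EFin \o bessel_density u).
Proof.
move=> Su; apply/integrableP; split; first by apply/measurable_EFinP; exact: bessel_density_measurable.
under eq_integral do rewrite /= (ger0_norm (bessel_density_ge0 _ _)).
by rewrite -sobolev_norm_sqr // ltry.
Qed.

Lemma sobolev_normE u : schwartz u ->
  `|embed H u| ^+ 2 = (\int[leb3 R]_x bessel_density u x)%:C.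
Proof.
move=> Su; rewrite /Rintegral -sobolev_norm_sqr //= rmorphXn /=; congr (_ ^+ 2).
by rewrite RRe_real // normr_real.
Qed.

(** By linearity of [bessel k] the identity holds pointwise between densities; all of them are
    integrable, so it survives integration. *)
Lemma embed_polar (r : R) u u' v : schwartz u -> schwartz u' -> schwartz v ->
  let f := embed H u in let f' := embed H u' in let g := embed H v in
  `|r%:C *: f + f' + g| ^+ 2 - `|r%:C *: f + f' - g| ^+ 2 =
  r%:C * (`|f + g| ^+ 2 - `|f - g| ^+ 2) + (`|f' + g| ^+ 2 - `|f' - g| ^+ 2).
Proof.
move=> Su Su' Sv f f' g.
have eD w w' : schwartz w -> schwartz w' -> embed H w + embed H w' = embed H (1 *: w + w').
  by move=> ? ?; rewrite embed_linear // scale1r.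
have eB w w' : schwartz w -> schwartz w' -> embed H w - embed H w' = embed H (-1 *: w' + w).
  by move=> ? ?; rewrite embed_linear // scaleN1r addrC.
have S1 := schwartz_comb (r%:C) Su Su'.
have SD (w w' : R * R * R -> R[i]) : schwartz w -> schwartz w' -> schwartz (1 *: w + w').
  by exact: schwartz_comb.
have SB (w w' : R * R * R -> R[i]) : schwartz w -> schwartz w' -> schwartz (-1 *: w' + w).
  by move=> ? ?; exact: schwartz_comb.
have I w : schwartz w -> (leb3 R).-integrable setT (EFin \o bessel_density w).
  by move=> Sw; exact: bessel_density_integrable.
have dif w w' : schwartz w -> schwartz w' ->
    `|embed H w + embed H w'| ^+ 2 - `|embed H w - embed H w'| ^+ 2 =
    (\int[leb3 R]_x (bessel_density (1 *: w + w') x - bessel_density (-1 *: w' + w) x))%:C.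
  move=> Sw Sw'; rewrite (eD _ _ Sw Sw') (eB _ _ Sw Sw').
  rewrite (sobolev_normE (SD _ _ Sw Sw')) (sobolev_normE (SB _ _ Sw Sw')) -rmorphB /=.
  by rewrite RintegralB //; apply: I; [exact: SD|exact: SB].
have IB w w' : schwartz w -> schwartz w' -> (leb3 R).-integrable setT
    (EFin \o (fun x => bessel_density (1 *: w + w') x - bessel_density (-1 *: w' + w) x)).
  by move=> Sw Sw'; exact: (integrableB measurableT (I _ (SD _ _ Sw Sw')) (I _ (SB _ _ Sw Sw'))).
have i1 := IB _ _ Su Sv.
have i2 := IB _ _ Su' Sv.
rewrite /f /f' /g -(embed_linear _ _ Su Su') (dif _ _ S1 Sv) (dif _ _ Su Sv) (dif _ _ Su' Sv).
rewrite -rmorphM -rmorphD /=; congr (_%:C).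
rewrite -(RintegralZl r measurableT i1).
rewrite -RintegralD //; last exact: (@integrableZl _ _ _ (leb3 R) setT measurableT r _ i1).
apply: eq_Rintegral => x _; rewrite /bessel_density.
have bl a w w' : schwartz w -> schwartz w' ->
  bessel k (a *: w + w') x = a * bessel k w x + bessel k w' x by move=> ? ?; exact: bessel_linear.
rewrite (bl _ _ _ S1 Sv) (bl _ _ _ Su Su') (bl _ _ _ Sv S1) (bl _ _ _ Su Su').
rewrite (bl _ _ _ Su Sv) (bl _ _ _ Sv Su) (bl _ _ _ Su' Sv) (bl _ _ _ Sv Su').
by move: (bessel k u x) (bessel k u' x) (bessel k v x) => [? ?] [? ?] [? ?] /=; ring.
Qed.

End SobolevNorm.

(** * The Hilbert space structure *)

Section Density.
Variable R : realType.
Local Notation C := R[i].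

Lemma dense_eq (V : topologicalType) (W : normedModType C) (A : set V) (phi psi : V -> W) :
  dense A -> continuous phi -> continuous psi -> {in A, phi =1 psi} -> phi =1 psi.
Proof.
move=> dA cphi cpsi eqA x; apply/eqP; rewrite -subr_eq0; apply: contraT => ne.
pose D := (fun y => phi y - psi y) @^-1` [set z | z != 0].
have oD : open D.
  apply: open_comp; last first.
    have -> : [set z : W | z != 0] = ~` [set 0].
      by apply/seteqP; split => z /= /eqP.
    apply: closed_openC; apply: accessible_closed_set1.
    exact: hausdorff_accessible (@norm_hausdorff _ _).
  by move=> y _; apply: cvgB; [exact: cphi|exact: cpsi].
have [|y [Dy Ay]] := dA D _ oD; first by exists x.
by move: Dy; rewrite /D /= (eqA _ (mem_set Ay)) subrr eqxx.
Qed.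

Lemma continuous_affine_sqr_norm (V : normedModType C) (a : C) (b : V) :
  continuous (fun f : V => `|a *: f + b| ^+ 2 : C^o).
Proof.
move=> f; have cn : {for f, continuous (fun f : V => `|a *: f + b| : C^o)}.
  apply: (@continuous_comp _ _ _ (fun f : V => a *: f + b) (fun f => `|f| : C^o)).
    by apply: cvgD; [exact: scaler_continuous|exact: cvg_cst].
  exact: norm_continuous.
exact: (cvgM cn cn).
Qed.

Lemma lipschitz_continuous (V W : normedModType C) (phi : V -> W) (M : C) :
  (forall x y, `|phi x - phi y| <= M * `|x - y|) -> continuous phi.
Proof.
move=> phiM x; apply/cvgrPdist_lt => e e0.
have M1 : 0 < `|M| + 1 by rewrite ltr_wpDl.
near=> y; apply: (@le_lt_trans _ _ ((`|M| + 1) * `|x - y|)).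
  have [->|xy] := eqVneq x y; first by rewrite !subrr !normr0 mulr0.
  apply: le_trans (phiM _ _) _; rewrite ler_wpM2r //.
  (* The order of [R[i]] is partial: [M] can be compared with its norm only once it is real, which
     the bound at a pair of distinct points forces. *)
  have : M \is Num.real.
    have n0 : 0 < `|x - y| by rewrite normr_gt0 subr_eq0.
    have := le_trans (normr_ge0 _) (phiM x y).
    by rewrite pmulr_lge0 // => /ger0_real.
  by move=> /real_ler_norm h; apply: le_trans h _; rewrite lerDl.
rewrite mulrC -ltr_pdivlMr //; near: y.
by apply: cvgr_dist_lt; [exact: cvg_id|exact: divr_gt0].
Unshelve. all: end_near. Qed.

End Density.

Section SobolevPolar.
Variables (R : realType) (k s : R) (H : sobolev k s).
Hypothesis k_le0 : k <= 0.
Local Open Scope complex_scope.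

(** Both sides are continuous in each variable, so the identity passes from Schwartz functions to
    the completion one variable at a time: [g], then [f'], then [f]. *)
Lemma sobolev_polar (r : R) (f f' g : H) :
  `|r%:C *: f + f' + g| ^+ 2 - `|r%:C *: f + f' - g| ^+ 2 =
  r%:C * (`|f + g| ^+ 2 - `|f - g| ^+ 2) + (`|f' + g| ^+ 2 - `|f' - g| ^+ 2).
Proof.
have dH := @embed_dense _ _ _ H.
have cn := @continuous_affine_sqr_norm R H.
have c1 (b : H) : continuous (fun x : H => `|x + b| ^+ 2 : R[i]^o).
  rewrite (_ : (fun _ => _) = (fun x => `|1 *: x + b| ^+ 2 : R[i]^o)); first exact: cn.
  by apply/funext => x; rewrite scale1r.
have c2 (b : H) : continuous (fun x : H => `|b - x| ^+ 2 : R[i]^o).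
  rewrite (_ : (fun _ => _) = (fun x => `|-1 *: x + b| ^+ 2 : R[i]^o)); first exact: cn.
  by apply/funext => x; rewrite scaleN1r addrC.
have c3 (b : H) : continuous (fun x : H => `|b + x| ^+ 2 : R[i]^o).
  rewrite (_ : (fun _ => _) = (fun x => `|x + b| ^+ 2 : R[i]^o)); first exact: c1.
  by apply/funext => x; rewrite addrC.
have cM (a : R[i]) (F : H -> R[i]^o) : continuous F -> continuous (fun x => a * F x : R[i]^o).
  by move=> cF x; apply: cvgM; [exact: cvg_cst|exact: cF].
have cB (F G : H -> R[i]^o) : continuous F -> continuous G -> continuous (fun x => F x - G x).
  by move=> cF cG x; apply: cvgB; [exact: cF|exact: cG].
have cA (F G : H -> R[i]^o) : continuous F -> continuous G -> continuous (fun x => F x + G x).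
  by move=> cF cG x; apply: cvgD; [exact: cF|exact: cG].
have cc (a : R[i]) : continuous (fun _ : H => a : R[i]^o) by move=> ?; exact: cvg_cst.
pose Q (a b : H) : R[i]^o := `|a + b| ^+ 2 - `|a - b| ^+ 2.
have cQr a : continuous (Q a) by exact: (cB _ _ (c3 a) (c2 a)).
have cQl b : continuous (Q^~ b) by exact: (cB _ _ (c1 b) (c1 (- b))).
have cQa a c b : continuous (fun x => Q (a *: x + c) b).
  rewrite (_ : (fun _ => _) = (fun x => `|a *: x + (c + b)| ^+ 2 - `|a *: x + (c - b)| ^+ 2 : R[i]^o)).
    exact: (cB _ _ (cn _ _) (cn _ _)).
  by apply/funext => x; rewrite /Q !addrA.
have cQb a b : continuous (fun x => Q (a + x) b).
  rewrite (_ : (fun _ => _) = (fun x => Q (1 *: x + a) b)); first exact: cQa.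
  by apply/funext => x; rewrite scale1r addrC.
suff : Q (r%:C *: f + f') g = r%:C * Q f g + Q f' g by [].
pose phi1 g := Q (r%:C *: f + f') g; pose psi1 g := r%:C * Q f g + Q f' g.
apply: (@dense_eq _ _ _ _ phi1 psi1 dH _ _ _ g); rewrite {}/phi1 {}/psi1.
- exact: cQr.
- exact: (cA _ _ (cM _ _ (cQr f)) (cQr f')).
move=> _ /set_mem[v Sv <-].
pose phi2 f' := Q (r%:C *: f + f') (embed H v).
pose psi2 f' := r%:C * Q f (embed H v) + Q f' (embed H v).
apply: (@dense_eq _ _ _ _ phi2 psi2 dH _ _ _ f'); rewrite {}/phi2 {}/psi2.
- exact: cQb.
- exact: (cA _ _ (cc _) (cQl _)).
move=> _ /set_mem[u' Su' <-].
pose phi3 f := Q (r%:C *: f + embed H u') (embed H v).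
pose psi3 f := r%:C * Q f (embed H v) + Q (embed H u') (embed H v).
apply: (@dense_eq _ _ _ _ phi3 psi3 dH _ _ _ f); rewrite {}/phi3 {}/psi3.
- exact: cQa.
- exact: (cA _ _ (cM _ _ (cQl _)) (cc _)).
move=> _ /set_mem[u Su <-]; rewrite /Q.
exact: (embed_polar k_le0 H r Su Su' Sv).
Qed.

End SobolevPolar.

(* The norm comes from an inner product (Jordan - von Neumann): its real
   polar form is linear over the reals. *)
Definition polar_linear (R : realType) (V : normedModType R[i]) : Prop :=
  forall (r : R[i]) (f h g : V), r \is Num.real ->
  `|r *: f + h + g| ^+ 2 - `|r *: f + h - g| ^+ 2 =
  r * (`|f + g| ^+ 2 - `|f - g| ^+ 2) + (`|h + g| ^+ 2 - `|h - g| ^+ 2).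

(** * The inner product obtained by polarization *)

Section PolarForm.
Variables (R : realType) (V : normedModType R[i]).
Implicit Types f g h : V.
Local Notation C := R[i].

Hypothesis polar : polar_linear V.

Definition qform f g : C := 4^-1 * (`|f + g| ^+ 2 - `|f - g| ^+ 2).
(** [qform f g] is the real part of the inner product; the imaginary part is the real part of (f,
    ig), because (f, ig) = -i (f, g). *)
Definition pform f g : C := qform f g + 'i * qform f ('i *: g).

Lemma imaginary_sqr : 'i * 'i = -1 :> C. Proof. by rewrite -expr2 sqrCi. Qed.

Lemma qform_lin (r : C) f h g : r \is Num.real ->
  qform (r *: f + h) g = r * qform f g + qform h g.
Proof. by move=> rr; rewrite /qform polar //; ring. Qed.

Lemma qform0l g : qform 0 g = 0.
Proof. by rewrite /qform add0r sub0r normrN subrr mulr0. Qed.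

Lemma qformDl f h g : qform (f + h) g = qform f g + qform h g.
Proof. by have := qform_lin f h g (real1 _); rewrite scale1r mul1r. Qed.

Lemma qformZl (r : C) f g : r \is Num.real -> qform (r *: f) g = r * qform f g.
Proof. by move=> rr; have := qform_lin f 0 g rr; rewrite addr0 qform0l addr0. Qed.

Lemma qformC f g : qform f g = qform g f.
Proof. by rewrite /qform (addrC f) distrC. Qed.

Lemma qformNr f g : qform f (- g) = - qform f g.
Proof. by rewrite /qform opprK; ring. Qed.

Lemma qform_ii f g : qform ('i *: f) ('i *: g) = qform f g.
Proof. by rewrite /qform -scalerDr -scalerBr !normrZ normCi !mul1r. Qed.

Lemma qform_il f g : qform ('i *: f) g = - qform f ('i *: g).
Proof.
rewrite -qformNr -scaleNr -(qform_ii f (- 'i *: g)) scalerA mulrN imaginary_sqr opprK.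
by rewrite scale1r.
Qed.

Lemma qform_conj f g : (qform f g)^* = qform f g.
Proof.
apply: conj_Creal.
by rewrite realM ?realV ?realn // realB // realX ?normr_real.
Qed.

Lemma qformff f : qform f f = `|f| ^+ 2.
Proof.
have ff : f + f = 2%:R *: f by rewrite scaler_nat mulr2n.
rewrite /qform subrr normr0 expr0n /= subr0 ff normrZ exprMn normr_nat.
by rewrite -natrX mulrA mulVf ?mul1r ?pnatr_eq0.
Qed.

Lemma qform_iff f : qform f ('i *: f) = 0.
Proof.
rewrite /qform (_ : f - 'i *: f = - 'i *: (f + 'i *: f)); last first.
  by rewrite scalerDr scalerA mulNr imaginary_sqr opprK scale1r scaleNr addrC.
by rewrite normrZ normrN normCi mul1r subrr mulr0.
Qed.

Lemma pformff f : pform f f = `|f| ^+ 2.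
Proof. by rewrite /pform qformff qform_iff mulr0 addr0. Qed.

Lemma pformDl f h g : pform (f + h) g = pform f g + pform h g.
Proof. by rewrite /pform !qformDl; ring. Qed.

Lemma pform_il f g : pform ('i *: f) g = 'i * pform f g.
Proof. by rewrite /pform qform_ii qform_il mulrDr mulrA imaginary_sqr mulN1r addrC. Qed.

Lemma pformZl (a : C) f g : pform (a *: f) g = a * pform f g.
Proof.
rewrite [a]Crect scalerDl pformDl mulrDl; congr (_ + _).
  by rewrite /pform !qformZl ?Creal_Re //; ring.
by rewrite -scalerA pform_il /pform !qformZl ?Creal_Im //; ring.
Qed.

Lemma conjC_add (x y : C) : (x + y)^* = x^* + y^*. Proof. exact: rmorphD. Qed.

Lemma conjC_mul (x y : C) : (x * y)^* = x^* * y^*. Proof. exact: rmorphM. Qed.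

Lemma pformC f g : pform g f = (pform f g)^*.
Proof.
rewrite /pform conjC_add (conjC_mul 'i) conjCi !qform_conj (qformC g f).
by rewrite (qformC g) qform_il mulrN mulNr.
Qed.

Lemma pformNl f g : pform (- f) g = - pform f g.
Proof. by rewrite -scaleN1r pformZl mulN1r. Qed.

Lemma pformBl f h g : pform (f - h) g = pform f g - pform h g.
Proof. by rewrite pformDl pformNl. Qed.

Lemma pform0l g : pform 0 g = 0.
Proof. by rewrite -(scale0r 0) pformZl mul0r. Qed.

Lemma pform0r g : pform g 0 = 0.
Proof. by rewrite pformC pform0l rmorph0. Qed.

Lemma pformDr f g h : pform f (g + h) = pform f g + pform f h.
Proof. by rewrite pformC pformDl (conjC_add (pform g f)) -!pformC. Qed.

Lemma pformZr a f g : pform f (a *: g) = a^* * pform f g.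
Proof. by rewrite pformC pformZl (conjC_mul a) -pformC. Qed.

Lemma pform_suml (I : Type) (s : seq I) (F : I -> V) g :
  pform (\sum_(i <- s) F i) g = \sum_(i <- s) pform (F i) g.
Proof. by elim/big_rec2: _ => [|i x y _ <-]; rewrite ?pform0l // pformDl. Qed.

Lemma pform_sumr (I : Type) (s : seq I) (F : I -> V) g :
  pform g (\sum_(i <- s) F i) = \sum_(i <- s) pform g (F i).
Proof.
by elim/big_rec2: _ => [|i x y _ <-]; rewrite ?pform0r // pformDr.
Qed.

Lemma pythagoras f g : pform f g = 0 -> `|f + g| ^+ 2 = `|f| ^+ 2 + `|g| ^+ 2.
Proof.
move=> fg; have gf : pform g f = 0 by rewrite pformC fg rmorph0.
by rewrite -!pformff pformDl !pformDr fg gf addr0 add0r.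
Qed.

Section Orthonormal.
Variable e : nat -> V.
Hypothesis e01 : forall i, e i = 0 \/ `|e i| = 1.
Hypothesis eorth : forall i j, i != j -> pform (e i) (e j) = 0.

Definition osum (c : nat -> C) (n : nat) : V := \sum_(i < n) c i *: e i.
Definition oproj f (n : nat) : V := osum (fun i => pform f (e i)) n.

Lemma pform_osum c n j : (j < n)%N -> pform (osum c n) (e j) = c j * `|e j| ^+ 2.
Proof.
move=> jn; rewrite /osum pform_suml (bigD1 (Ordinal jn)) //= pformZl pformff.
rewrite big1 ?addr0 // => i /= ij; rewrite pformZl eorth ?mulr0 //.
Qed.

Lemma oproj_orth f n j : (j < n)%N -> pform (f - oproj f n) (e j) = 0.
Proof.
move=> jn; rewrite pformBl pform_osum //.
by case: (e01 j) => ->; rewrite ?pform0r ?mul0r ?subrr // expr1n mulr1 subrr.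
Qed.

Lemma oproj_orth_osum f n c : pform (f - oproj f n) (osum c n) = 0.
Proof.
rewrite pform_sumr big1 // => i _.
by rewrite pformZr oproj_orth ?mulr0.
Qed.

Lemma osumB c d n : osum c n - osum d n = osum (fun i => c i - d i) n.
Proof. by rewrite /osum -sumrB; apply: eq_bigr => i _; rewrite scalerBl. Qed.

Lemma sqr_norm_osum c n : `|osum c n| ^+ 2 = \sum_(i < n) `|c i| ^+ 2 * `|e i| ^+ 2.
Proof.
rewrite -pformff {2}/osum pform_sumr; apply: eq_bigr => i _.
by rewrite pformZr pform_osum // normCK; ring.
Qed.

Lemma sqr_norm_osum_le c n : `|osum c n| ^+ 2 <= \sum_(i < n) `|c i| ^+ 2.
Proof.
rewrite sqr_norm_osum; apply: ler_sum => i _.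
by case: (e01 i) => ->; rewrite ?normr0 ?expr0n ?mulr0 ?exprn_ge0 // expr1n mulr1.
Qed.

(** Pythagoras for [f] as residue plus projection; a vanishing [e i] contributes 0 to both sides. *)
Lemma bessel_inequality f n : \sum_(i < n) `|pform f (e i)| ^+ 2 <= `|f| ^+ 2.
Proof.
rewrite -[f in leRHS](subrK (oproj f n)) (@pythagoras (f - oproj f n)) ?oproj_orth_osum //.
rewrite (sqr_norm_osum _ n) (_ : \sum_(i < n) _ = \sum_(i < n) `|pform f (e i)| ^+ 2 * `|e i| ^+ 2).
  by rewrite lerDr exprn_ge0.
apply: eq_bigr => i _; case: (e01 i) => ->; last by rewrite expr1n mulr1.
by rewrite pform0r !normr0 expr0n mulr0.
Qed.

(** Passing to another combination adds a vector of the span, which is orthogonal to the residue and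
    so can only increase the norm. *)
Lemma oproj_best f n c : `|f - oproj f n| <= `|f - osum c n|.
Proof.
rewrite -(ler_pXn2r (ltn0Sn 1)) ?nnegrE //.
rewrite (_ : f - osum c n = (f - oproj f n) + osum (fun i => pform f (e i) - c i) n).
  by rewrite (@pythagoras (f - oproj f n)) ?oproj_orth_osum // lerDl exprn_ge0.
by rewrite -osumB addrA subrK.
Qed.

End Orthonormal.
End PolarForm.

(** * Orthogonal expansions in the range of a compact operator *)

Section GramSchmidt.
Variables (R : realType) (V : normedModType R[i]).
Local Notation C := R[i].
Hypothesis polar : polar_linear V.
Variable d : nat -> V.

Let residue (s : seq V) (f : V) : V := f - \sum_(g <- s) pform f g *: g.

(* As [0^-1 = 0], a vanishing residue contributes the vector [0]. *)
Fixpoint gram_seq (n : nat) : seq V :=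
  if n is m.+1 then
    let r := residue (gram_seq m) (d m) in rcons (gram_seq m) (`|r|^-1 *: r)
  else [::].

Definition gram (n : nat) : V := last 0 (gram_seq n.+1).

Lemma gram_seqE n : gram_seq n = [seq gram i | i <- iota 0 n].
Proof.
elim: n => [//|n IH]; rewrite -addn1 iotaD map_cat /= add0n -IH addn1 /=.
by rewrite /gram /= last_rcons cats1.
Qed.

Let gres (n : nat) : V := d n - osum gram (fun i => pform (d n) (gram i)) n.

Lemma gramE n : gram n = `|gres n|^-1 *: gres n.
Proof.
rewrite /gram /= last_rcons /residue gram_seqE big_map /gres /osum.
by rewrite -[iota 0 n]/(iota 0 n) -val_enum_ord big_map big_enum.
Qed.

Lemma gram01 n : gram n = 0 \/ `|gram n| = 1.
Proof.
rewrite gramE; have [->|n0] := eqVneq (gres n) 0; first by left; rewrite scaler0.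
by right; rewrite normrZ normfV normr_id mulVf // normr_eq0.
Qed.

Lemma gram_orth i j : i != j -> pform (gram i) (gram j) = 0.
Proof.
have lt_orth n : forall j, (j < n)%N -> pform (gram n) (gram j) = 0.
  elim/ltn_ind: n => n IH k kn; rewrite gramE pformZl //.
  suff -> : pform (gres n) (gram k) = 0 by rewrite mulr0.
  rewrite /gres /osum (pformBl polar) (pform_suml polar) (bigD1 (Ordinal kn)) //=.
  rewrite big1 ?addr0 => [|l lk].
    rewrite (pformZl polar) pformff.
    by case: (gram01 k) => ->; rewrite ?(pform0r polar) ?mul0r ?subrr //
       expr1n mulr1 subrr.
  (* The cross terms vanish by the induction hypothesis at the larger of the two indices. *)
  rewrite (pformZl polar); case: (ltngtP l k) => [lk'|lk'|lk'].
  - by rewrite (pformC (gram k) (gram l)) IH // conjC0 mulr0.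
  - by rewrite IH ?mulr0.
  - by move: lk; rewrite -val_eqE /= lk' eqxx.
move=> ij; case: (ltngtP i j) => [lij|lji|eij].
- by rewrite (pformC (gram j) (gram i)) lt_orth // conjC0.
- by rewrite lt_orth.
- by rewrite eij eqxx in ij.
Qed.

(** Undoes the normalization: [d k] is its projection on the earlier vectors plus the norm of
    [gres k] times [gram k], also when the residue is 0. *)
Lemma gram_span k n : (k < n)%N -> exists c : nat -> C, d k = osum gram c n.
Proof.
move=> kn; pose c i := if (i < k)%N then pform (d k) (gram i)
                       else if i == k then `|gres k| else 0.
exists c; rewrite /osum -(big_mkord xpredT (fun i => c i *: gram i)).
rewrite (big_cat_nat _ (n := k.+1)) //= [X in _ + X]big1_seq ?addr0; last first.
  move=> i /=; rewrite mem_index_iota => /andP[ki _].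
  by rewrite /c ltnNge (ltnW ki) /= gtn_eqF // scale0r.
rewrite big_nat_recr //= [in X in _ + X]/c ltnn eqxx gramE.
rewrite (eq_big_nat _ _ (F2 := fun i => pform (d k) (gram i) *: gram i)); last first.
  by move=> i /andP[_ ik]; rewrite /c ik.
rewrite big_mkord scalerA; have [g0|n0] := eqVneq (gres k) 0.
  by rewrite g0 scaler0 addr0; apply/eqP; rewrite -subr_eq0 -[X in X == 0]/(gres k) g0.
by rewrite mulfV ?normr_eq0 // scale1r /gres /osum addrC subrK.
Qed.

(** For n > k the vector [d k] lies in the span of the first n vectors, so the projection of [f] is
    at least as close to [f] as [d k] is. *)
Lemma oproj_gram_cvg f :
  (forall eps : C, 0 < eps -> exists k, `|f - d k| < eps) ->
  forall eps : C, 0 < eps -> exists N, forall n, (N <= n)%N -> `|f - oproj gram f n| < eps.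
Proof.
move=> fd eps e0; have [k fk] := fd _ e0; exists k.+1 => n kn.
have [c dk] := gram_span kn; apply: le_lt_trans fk; rewrite dk.
exact: (oproj_best polar gram01 gram_orth).
Qed.

End GramSchmidt.

(** * Finite nets for compact operators *)

Section CompactOperator.
Variables (R : realType) (V W : normedModType R[i]).
Local Notation C := R[i].
Variable T : {linear V -> W}.
Hypothesis cT : compact_operator T.

Lemma bounded_closed_ball n : bounded_set [set x : V | `|x| <= n%:R].
Proof. by exists n%:R; split; rewrite ?realn // => M nM x /= xn; exact: le_trans xn (ltW nM). Qed.

Lemma compact_operator_cover n m : exists F : {fset W}, forall u, `|u| <= n%:R ->
  exists2 y, y \in F & `|T u - y| < m.+1%:R^-1.
Proof.
have := cT (bounded_closed_ball n); rewrite precompactE compact_cover.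
have m0 : (0 : C) < m.+1%:R^-1 by rewrite invr_gt0.
(* The closure of the image is covered by the interiors of all balls of radius 1/(m+1), with centres
   anywhere in [W]. *)
move=> /(_ W setT (fun y => (ball y (m.+1%:R^-1 : C))^°)).
case=> [y _||F _ FT].
- exact: open_interior.
- by move=> y _; exists y => //; apply: nbhsx_ballx; exact: m0.
exists F => u un; have [|y /= yF yT] := FT (T u).
  by apply: subset_closure; exists u.
exists y => //; move/interior_subset: yT; rewrite -ball_normE /= distrC; exact.
Qed.

Lemma compact_operator_bounded :
  exists2 M : C, 0 <= M & forall u, `|T u| <= M * `|u|.
Proof.
(* A net of mesh 1 for the image of the unit ball bounds that image by 1 plus the sum of the norms
   of the net points. *)
have [F FT] := compact_operator_cover 1 0.
have M0 : (0 : C) <= 1 + \sum_(y <- F) `|y| by rewrite addr_ge0 // sumr_ge0.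
exists (1 + \sum_(y <- F) `|y|) => // u; have [->|u0] := eqVneq u 0.
  by rewrite linear0 !normr0 mulr0.
have nu : 0 < `|u| by rewrite normr_gt0.
rewrite -ler_pdivrMr //.
have -> : `|T u| / `|u| = `|T (`|u|^-1 *: u)|.
  by rewrite linearZ /= normrZ normfV normr_id mulrC.
have [|y yF Ty] := FT (`|u|^-1 *: u).
  by rewrite normrZ normfV normr_id mulVf // gt_eqF.
rewrite -[T _](subrK y); apply: le_trans (ler_normD _ _) _; apply: lerD.
  by rewrite -[1]invr1; exact: ltW.
by rewrite (big_rem y) //= lerDl sumr_ge0.
Qed.

Lemma compact_operator_separable :
  exists d : nat -> W, forall u (eps : C), 0 < eps -> exists k, `|T u - d k| < eps.
Proof.
have /choice[F0 cover] : forall nm : nat * nat, exists F : {fset W},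
    forall u, `|u| <= nm.1%:R -> exists2 y, y \in F & `|T u - y| < nm.2.+1%:R^-1.
  by move=> [n m]; exact: compact_operator_cover.
(* [k] encodes a radius, a mesh and a position in the corresponding net; the default 0 for other
   codes does no harm, as only closeness of some [d k] is claimed. *)
exists (fun k : nat => if (choice.unpickle k : option (nat * nat * nat)%type) is Some (n, m, i)
  then nth 0 (F0 (n, m)) i else 0).
move=> u eps e0.
have archi (x : C) : 0 <= x -> exists n : nat, x < n.+1%:R.
  move=> x0; exists (Num.trunc (complex.Re x)).
  rewrite -[x]RRe_real ?ger0_real // -(rmorph_nat (real_complex R)) ltcR.
  exact: truncnS_gt.
have [n un] := archi _ (normr_ge0 u).
have [m me] : exists m : nat, eps^-1 < m.+1%:R by apply: archi; rewrite invr_ge0 ltW.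
have [y yF yT] := cover (n.+1, m) u (ltW un).
exists (choice.pickle (n.+1, m, index y (F0 (n.+1, m)))); rewrite choice.pickleK nth_index //.
by apply: lt_trans yT _; rewrite -[eps]invrK ltf_pV2 ?posrE ?invr_gt0.
Qed.

End CompactOperator.

(** * Factorization through l^2 *)

Section Factorization.
Variables (R : realType) (k' s' k s : R).
Variables (Hd : sobolev k' s') (H : sobolev k s) (B : L2_duality Hd H).
Local Notation C := R[i].

(** Both vectors represent the functional [B f], whose representative is unique by
    [pairing_perfect]. *)
Lemma pairing_eqP (f g : Hd) : (forall u, B f u = B g u) -> f = g.
Proof.
move=> fg; have [M BM] := pairing_bounded B.
have [||h [_ hu]] := @pairing_perfect _ _ _ _ _ _ _ B (B f).
- exact: pairing_conj_linear.
- by exists (M * `|f|) => u; exact: BM.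
by rewrite -(hu f) // -(hu g) // => u; rewrite fg.
Qed.

Lemma pairing_sum (n : nat) (c : nat -> C) (e : nat -> Hd) u :
  B (\sum_(i < n) c i *: e i) u = \sum_(i < n) c i * B (e i) u.
Proof.
elim: n => [|n IH].
  by rewrite !big_ord0 -(scale0r 0) -[X in B X]addr0 pairing_linear mul0r add0r;
     have := pairing_linear B u 1 0 0; rewrite scale1r addr0 mul1r => /(congr1 (fun x => x - B 0 u));
     rewrite addrK subrr.
by rewrite !big_ord_recr /= addrC pairing_linear IH addrC.
Qed.

(** Perfectness of the duality represents u -> dot a (w u) by a vector of [Hd], the value of w* at
    [a]; uniqueness makes w* linear. The factorization then reduces to an identity between forms. *)
Lemma factorizes_intro (W : {linear H -> Hd}) (K : lmodType C) (dot : K -> K -> C)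
    (w : {linear H -> K}) (U : {linear K -> K}) :
  (forall c a b d, dot (c *: a + b) d = c * dot a d + dot b d) ->
  (forall c a b d, dot a (c *: b + d) = c^* * dot a b + dot a d) ->
  (exists M : C, forall u, sqrtC (dot (w u) (w u)) <= M * `|u|) ->
  (forall a, exists M : C, forall u, `|dot a (w u)| <= M * `|u|) ->
  (forall a b, dot (U a) b = dot a (U b)) ->
  (forall a b, dot (U a) (U b) = dot a b) ->
  (forall b, exists a, U a = b) ->
  (forall u v, B (W u) v = dot (U (w u)) (w v)) ->
  factorizes B W dot.
Proof.
move=> dotl dotr wM dotM Us Ui Usurj BW.
have ex a : exists f : Hd, forall u, B f u = dot a (w u).
  have [||f [fE _]] := @pairing_perfect _ _ _ _ _ _ _ B (fun u => dot a (w u)).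
  - by move=> c u v; rewrite linearP dotr.
  - exact: dotM.
  - by exists f.
have [g gE] := choice ex.
have glin : linear g.
  move=> c a b; apply: pairing_eqP => u.
  by rewrite pairing_linear !gE dotl.
pose gl := GRing.isLinear.Build C K Hd *:%R g glin.
pose wadj : {linear K -> Hd} := HB.pack_for {linear K -> Hd} g gl.
exists w, wadj, U; split => //.
by move=> u; apply: pairing_eqP => v; rewrite BW gE.
Qed.

End Factorization.

(** * Series of complex numbers *)

Section ComplexSeries.
Variable R : realType.
Local Notation C := R[i].
Local Notation normc := ComplexField.Normc.normc.
Implicit Types z : nat -> C.

Definition csummable z :=
  cvgn (series (fun n => complex.Re (z n))) /\ cvgn (series (fun n => complex.Im (z n))).

(** Taken componentwise, so that [ell2_dot] is convertible to a [csum]. *)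
Definition csum z : C := Complex
  (limn (series (fun n => complex.Re (z n)))) (limn (series (fun n => complex.Im (z n)))).

Lemma csummable_comb c z z' : csummable z -> csummable z' ->
  csummable (fun n => c * z n + z' n) /\
  csum (fun n => c * z n + z' n) = c * csum z + csum z'.
Proof.
move=> [zr zi] [zr' zi'].
have ReE : (fun n => complex.Re (c * z n + z' n)) =
    complex.Re c *: (fun n => complex.Re (z n)) + (- complex.Im c) *: (fun n => complex.Im (z n))
    + (fun n => complex.Re (z' n)).
  apply/funext => n; rewrite !fctE /GRing.scale /=.
  by case: c (z n) (z' n) => [? ?] [? ?] [? ?] /=; ring.
have ImE : (fun n => complex.Im (c * z n + z' n)) =
    complex.Re c *: (fun n => complex.Im (z n)) + complex.Im c *: (fun n => complex.Re (z n))
    + (fun n => complex.Im (z' n)).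
  clear ReE; apply/funext => n; rewrite !fctE /GRing.scale /=.
  by case: c (z n) (z' n) => [? ?] [? ?] [? ?] /=; ring.
have Z (a : R) (f : nat -> R) : cvgn (series f) -> cvgn (series (a *: f)).
  by move=> cf; exact: is_cvg_seriesZ.
have D (f g : nat -> R) : cvgn (series f) -> cvgn (series g) -> cvgn (series (f + g)).
  by move=> cf cg; exact: is_cvg_seriesD.
rewrite /csummable /csum ReE ImE; split.
  by split; apply: (D) => //; apply: (D); exact: (Z).
have lin (a b : R) (f g h : nat -> R) : cvgn (series f) -> cvgn (series g) ->
    cvgn (series h) -> limn (series (a *: f + b *: g + h)) =
    a * limn (series f) + b * limn (series g) + limn (series h).
  move=> cf cg ch; rewrite (lim_seriesD (D _ _ (Z a _ cf) (Z b _ cg)) ch).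
  by rewrite (lim_seriesD (Z a _ cf) (Z b _ cg)) (lim_seriesZ a cf) (lim_seriesZ b cg).
rewrite (lin _ _ _ _ _ zr zi zr') (lin _ _ _ _ _ zi zr zi').
move: (limn _) (limn _) (limn _) (limn _) => p q p' q'.
clear; case: c => x y; apply/eqP; rewrite eq_complex /=.
by apply/andP; split; apply/eqP; ring.
Qed.

Lemma normc_ge0 (x : C) : 0 <= normc x.
Proof. by case: x => a b; exact: sqrtr_ge0. Qed.

Lemma norm_real_complex (x : C) : `|x| = (normc x)%:C%C.
Proof. by []. Qed.

(** Real and imaginary parts are each bounded by the dominating sum; the sum of the two bounds is a
    crude estimate of the modulus. *)
Lemma csummable_dominated z (t : nat -> R) : (forall n, normc (z n) <= t n) ->
  cvgn (series t) ->
  csummable z /\ `|csum z| <= (limn (series t) + limn (series t))%:C%C.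
Proof.
move=> zt ct.
have t0 n : 0 <= t n := le_trans (normc_ge0 _) (zt n).
have one (f : nat -> R) : (forall n, `|f n| <= t n) ->
    cvgn (series f) /\ `|limn (series f)| <= limn (series t).
  move=> ft; have cn : cvgn [normed series f].
    by apply: (series_le_cvg (v_ := t)) => // n; exact: normr_ge0.
  split; first exact: (@normed_cvg _ R^o).
  apply: le_trans (@lim_series_norm _ R^o _ cn) _; exact: lim_series_le.
have [cr br] : cvgn (series (fun n => complex.Re (z n))) /\
    `|limn (series (fun n => complex.Re (z n)))| <= limn (series t).
  apply: one => n; apply: le_trans (zt n); case: (z n) => a b /=.
  by rewrite -sqrtr_sqr ler_sqrt ?addr_ge0 ?sqr_ge0 // lerDl sqr_ge0.
have [ci bi] : cvgn (series (fun n => complex.Im (z n))) /\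
    `|limn (series (fun n => complex.Im (z n)))| <= limn (series t).
  apply: one => n; apply: le_trans (zt n); case: (z n) => a b /=.
  by rewrite -sqrtr_sqr ler_sqrt ?addr_ge0 ?sqr_ge0 // lerDr sqr_ge0.
split; first by split.
rewrite norm_real_complex lecR /csum /=.
set x := limn _ in br *; set y := limn _ in bi *; set T := limn _ in br bi *.
have T0 : 0 <= T := le_trans (normr_ge0 _) br.
rewrite -[leRHS]ger0_norm ?addr_ge0 // -sqrtr_sqr ler_sqrt ?sqr_ge0 //.
have : x ^+ 2 <= T ^+ 2 by rewrite -real_normK ?num_real // ler_pXn2r ?nnegrE.
have : y ^+ 2 <= T ^+ 2 by rewrite -[y ^+ 2]real_normK ?num_real // ler_pXn2r ?nnegrE.
by move=> ? ?; nra.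
Qed.

(** As summability is known, the sum can be read off the even partial sums, in which interleaved
    coordinates form complete pairs. *)
Lemma csum_double z L : csummable z ->
  (forall eps : C, 0 < eps -> exists N, forall n, (N <= n)%N ->
     `|L - \sum_(i < n.*2) z i| < eps) -> csum z = L.
Proof.
move=> [cr ci] zL.
have ReS n : series (fun n => complex.Re (z n)) n = complex.Re (\sum_(i < n) z i).
  rewrite seriesEord /=; elim: n => [|n IH]; first by rewrite !big_ord0.
  by rewrite !big_ord_recr /= IH; case: (\sum_(i < n) z i) (z n) => [? ?] [? ?].
have ImS n : series (fun n => complex.Im (z n)) n = complex.Im (\sum_(i < n) z i).
  rewrite seriesEord /=; elim: n => [|n IH]; first by rewrite !big_ord0.
  by rewrite !big_ord_recr /= IH; case: (\sum_(i < n) z i) (z n) => [? ?] [? ?].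
have lim (f : nat -> R) (l : R) : cvgn f ->
    (forall eps : R, 0 < eps -> exists N, forall n, (N <= n)%N -> `|l - f n.*2| < eps) ->
    limn f = l.
  move=> cf fl.
  have h1 : (f \o double) @ \oo --> limn f.
    move=> P /cf[N _ fN]; exists N => // n /= Nn; apply: fN.
    by rewrite /= (leq_trans Nn) // -addnn leq_addr.
  have h2 : (f \o double) @ \oo --> l.
    apply/cvgrPdist_lt => eps e0; have [N fN] := fl _ e0.
    by exists N => // n /= Nn; exact: fN.
  exact: (cvg_unique _ h1 h2).
have zL' eps : 0 < eps -> exists N, forall n, (N <= n)%N ->
    normc (L - \sum_(i < n.*2) z i) < eps.
  move=> e0; have [|N zN] := zL (eps%:C)%C; first by rewrite ltcR.
  by exists N => n /zN; rewrite norm_real_complex ltcR.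
rewrite /csum; apply/eqP; rewrite eq_complex /=; apply/andP; split; apply/eqP; apply: lim => //.
- move=> eps /zL'[N zN]; exists N => n /zN; apply: le_lt_trans; rewrite ReS.
  case: L {zL zL' zN} => a b; case: (\sum_(i < _) _) => c d /=.
  by rewrite -sqrtr_sqr ler_sqrt ?addr_ge0 ?sqr_ge0 // lerDl sqr_ge0.
- move=> eps /zL'[N zN]; exists N => n /zN; apply: le_lt_trans; rewrite ImS.
  case: L {zL zL' zN} => a b; case: (\sum_(i < _) _) => c d /=.
  by rewrite -sqrtr_sqr ler_sqrt ?addr_ge0 ?sqr_ge0 // lerDr sqr_ge0.
Qed.

End ComplexSeries.

(** * Factorization through l^2 with alternating signs *)

Section Ell2Factorization.
Variable R : realType.
Local Notation C := R[i].
Local Notation normc := ComplexField.Normc.normc.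

Lemma ell2_dotE (a b : ell2 R) : ell2_dot a b = csum (fun n => a n * (b n)^*).
Proof. by []. Qed.

Lemma ell2_summable (a : ell2 R) : cvgn (series (fun n => normc (a n) ^+ 2)).
Proof. by case: a => a /= /asboolP. Qed.

(** Rests on |xy| <= |x|^2 + |y|^2 instead of Cauchy-Schwarz; the bound is not homogeneous, which is
    repaired later by rescaling. *)
Lemma ell2_dot_bound (a b : ell2 R) :
  csummable (fun n => a n * (b n)^*) /\
  `|ell2_dot a b| <= 2 * (limn (series (fun n => normc (a n) ^+ 2)) +
                          limn (series (fun n => normc (b n) ^+ 2)))%:C%C.
Proof.
have ca := @ell2_summable a; have cb := @ell2_summable b.
have [] := @csummable_dominated R (fun n => a n * (b n)^*)
  ((fun n => normc (a n) ^+ 2) + (fun n => normc (b n) ^+ 2)).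
- move=> n; rewrite ComplexField.Normc.normcM.
  have -> : normc (b n)^* = normc (b n).
    by apply: complexI; rewrite -!norm_real_complex norm_conjC.
  rewrite fctE; have := normc_ge0 (a n); have := normc_ge0 (b n).
  by move: (normc (a n)) (normc (b n)) => x y *; nra.
- exact: is_cvg_seriesD.
move=> cs; rewrite lim_seriesD // => le; split => //.
by rewrite mulr_natl mulr2n -rmorphD.
Qed.

Lemma ell2_dot_linearl c (a b d : ell2 R) :
  ell2_dot (c *: a + b) d = c * ell2_dot a d + ell2_dot b d.
Proof.
have [ca _] := ell2_dot_bound a d; have [cb _] := ell2_dot_bound b d.
rewrite !ell2_dotE -(csummable_comb c ca cb).2.
by congr csum; apply/funext => n /=; rewrite mulrDl mulrA.
Qed.

Lemma ell2_dot_linearr c (a b d : ell2 R) :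
  ell2_dot a (c *: b + d) = c^* * ell2_dot a b + ell2_dot a d.
Proof.
have [cb _] := ell2_dot_bound a b; have [cd _] := ell2_dot_bound a d.
rewrite !ell2_dotE -(csummable_comb c^* cb cd).2.
congr csum; apply/funext => n /=; rewrite -[(_ + _)^*]/((c * b n + d n)^*).
by rewrite conjC_add (conjC_mul c) mulrDr mulrCA.
Qed.

Lemma ell2_dot_ge0 (a : ell2 R) : 0 <= ell2_dot a a.
Proof.
have [[cr ci] _] := ell2_dot_bound a a.
have aa n : a n * (a n)^* = (normc (a n) ^+ 2)%:C%C.
  by rewrite -normCK norm_real_complex rmorphXn.
rewrite lecE /= eq_sym; apply/andP; split; last first.
  apply: limr_ge => //; apply: nearW => n; rewrite seriesEord /=.
  by apply: sumr_ge0 => i _; rewrite aa /= sqr_ge0.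
rewrite (_ : (fun n => _) = fun=> 0); last by apply/funext => n; rewrite aa.
rewrite (_ : series _ = fun=> 0) ?lim_cst ?eqxx //.
by apply/funext => n; rewrite seriesEord /= big1.
Qed.

Definition alt_sign (a : nat -> C) (n : nat) : C := (-1) ^+ n * a n.

Lemma alt_sign_summable (a : ell2 R) : alt_sign a \in @square_summable R.
Proof.
apply/asboolP; rewrite (_ : (fun n => _) = fun n => normc (a n) ^+ 2); first exact: ell2_summable.
apply/funext => n; rewrite /alt_sign ComplexField.Normc.normcM.
suff -> : normc ((-1) ^+ n : C) = 1 by rewrite mul1r.
by apply: complexI; rewrite -norm_real_complex normrX normrN1 expr1n.
Qed.

Definition ell2_alt (a : ell2 R) : ell2 R := Ell2 (alt_sign_summable a).

Lemma ell2_altK : involutive ell2_alt.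
Proof.
move=> a; apply: val_inj; apply/funext => n /=.
by rewrite /alt_sign mulrA -expr2 -exprM mulnC exprM sqrrN expr1n expr1n mul1r.
Qed.

Lemma ell2_alt_linear : linear ell2_alt.
Proof.
move=> c a b; apply: val_inj; apply/funext => n /=.
by rewrite /alt_sign /GRing.scale /= mulrDr mulrCA.
Qed.

HB.instance Definition _ :=
  GRing.isLinear.Build C (ell2 R) (ell2 R) *:%R ell2_alt ell2_alt_linear.

Lemma conj_sign n : ((-1) ^+ n : C)^* = (-1) ^+ n.
Proof. by apply: conj_Creal; rewrite realX // realN real1. Qed.

Lemma ell2_alt_sym a b : ell2_dot (ell2_alt a) b = ell2_dot a (ell2_alt b).
Proof.
rewrite !ell2_dotE; congr csum; apply/funext => n /=.
by rewrite /alt_sign (conjC_mul ((-1) ^+ n)) conj_sign mulrCA mulrA.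
Qed.

Variables (k' s' k s : R).
Variables (Hd : sobolev k' s') (H : sobolev k s) (B : L2_duality Hd H).

Lemma factorizes_ell2 (W : {linear H -> Hd}) (l : nat -> H -> C) (K : C) :
  (forall n, scalar (l n)) -> 0 <= K ->
  (forall u n, \sum_(i < n) `|l i u| ^+ 2 <= K * `|u| ^+ 2) ->
  (forall u v (eps : C), 0 < eps -> exists N, forall n, (N <= n)%N ->
    `|B (W u) v - \sum_(i < n.*2) (-1) ^+ i * l i u * (l i v)^*| < eps) ->
  factorizes B W (@ell2_dot R).
Proof.
move=> llin K0 lK lW.
have part u n : series (fun n => normc (l n u) ^+ 2) n <= complex.Re (K * `|u| ^+ 2).
  have := lK u n; rewrite lecE => /andP[_]; apply: le_trans.
  rewrite seriesEord /= (_ : complex.Re _ = \sum_(i < n) normc (l i u) ^+ 2) //.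
  elim: n => [|n IH]; first by rewrite !big_ord0.
  rewrite !big_ord_recr /= -IH norm_real_complex -rmorphXn /=.
  by case: (\sum_(i < n) _).
have ss u : (fun n => l n u) \in @square_summable R.
  apply/asboolP; apply: nondecreasing_is_cvgn.
    move=> n m nm; rewrite !seriesEnat /= (big_cat_nat _ nm) //= lerDl.
    by apply: sumr_ge0 => i _; rewrite sqr_ge0.
  by exists (complex.Re (K * `|u| ^+ 2)) => _ [n _ <-]; exact: part.
pose w0 u : ell2 R := Ell2 (ss u).
have lim_w u : limn (series (fun n => normc (w0 u n) ^+ 2)) <= complex.Re (K * `|u| ^+ 2).
  apply: limr_le; first exact: ell2_summable.
  by apply: nearW => n; exact: part.
have wlin : linear w0.
  move=> c u v; apply: val_inj; apply/funext => n /=.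
  by rewrite llin.
pose wl := GRing.isLinear.Build C H (ell2 R) *:%R w0 wlin.
pose w : {linear H -> ell2 R} := HB.pack_for {linear H -> ell2 R} w0 wl.
have Kreal u : (complex.Re (K * `|u| ^+ 2))%:C%C = K * `|u| ^+ 2.
  by rewrite RRe_real // ger0_real // mulr_ge0 // exprn_ge0.
apply: (@factorizes_intro _ _ _ _ _ _ _ B W (ell2 R) (@ell2_dot R) w ell2_alt).
- exact: ell2_dot_linearl.
- exact: ell2_dot_linearr.
(* The 4 is 2(1 + 1), from [ell2_dot_bound] with both arguments equal to [w u]. *)
- exists (sqrtC (4%:R * K)) => u.
  have [_ le] := ell2_dot_bound (w u) (w u).
  rewrite (ger0_norm (ell2_dot_ge0 _)) in le.
  have -> : sqrtC (4%:R * K) * `|u| = sqrtC (4%:R * K * `|u| ^+ 2).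
    by rewrite (@sqrtCM _ (4%:R * K)) ?nnegrE ?mulr_ge0 ?exprn_ge0 // sqrCK.
  rewrite ler_sqrtC ?nnegrE ?ell2_dot_ge0 ?mulr_ge0 ?exprn_ge0 //.
  apply: le_trans le _.
  rewrite -[X in _ <= X](_ : 2 * (K * `|u| ^+ 2 + K * `|u| ^+ 2) = _); last by ring.
  have := lim_w u; move: (limn _) => T TK.
  have two : (0 : C) <= 2 by [].
  apply: (ler_wpM2l two); rewrite -Kreal.
  have -> (x : R) : x%:C%C + x%:C%C = (x + x)%:C%C :> C by rewrite rmorphD.
  by rewrite lecR; apply: lerD.
- move=> a.
  exists (2 * (limn (series (fun n => normc (a n) ^+ 2)) + complex.Re K)%:C%C) => u.
  have [->|u0] := eqVneq u 0.
    rewrite linear0 normr0 mulr0 (_ : ell2_dot a 0 = 0) ?normr0 //.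
    have := ell2_dot_linearr 1 a 0 0; rewrite scale1r addr0 conjC1 mul1r.
    by move=> /(congr1 (fun x => x - ell2_dot a 0)); rewrite addrK subrr => ->.
  have nu : 0 < `|u| by rewrite normr_gt0.
  (* The additive bound is applied at a unit vector, and homogeneity restores the factor |u|. *)
  pose u' := `|u|^-1 *: u.
  have nu' : `|u'| = 1 by rewrite normrZ normfV normr_id mulVf // gt_eqF.
  have -> : ell2_dot a (w u) = `|u| * ell2_dot a (w u').
    rewrite /u' linearZ /=; have := ell2_dot_linearr (`|u|^-1) a (w u) 0.
    rewrite addr0 (_ : ell2_dot a 0 = 0); last first.
      have := ell2_dot_linearr 1 a 0 0; rewrite scale1r addr0 conjC1 mul1r.
      by move=> /(congr1 (fun x => x - ell2_dot a 0)); rewrite addrK subrr => ->.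
    rewrite addr0 conj_Creal ?realV ?normr_real // => ->.
    by rewrite mulrA mulfV ?mul1r // gt_eqF.
  rewrite normrM normr_id mulrC ler_pM2r //.
  have [_ le] := ell2_dot_bound a (w u'); apply: le_trans le _.
  rewrite ler_pM2l // lecR lerD2l; apply: le_trans (lim_w u') _.
  by rewrite nu' expr1n mulr1.
- exact: ell2_alt_sym.
(* A symmetric involution is unitary. *)
- by move=> a b; apply: etrans (ell2_alt_sym a (ell2_alt b)) _; rewrite ell2_altK.
- by move=> b; exists (ell2_alt b); exact: ell2_altK.
- move=> u v; rewrite ell2_dotE; apply/esym; apply: csum_double.
    by have [] := ell2_dot_bound (ell2_alt (w u)) (w v).
  exact: lW.
Qed.

End Ell2Factorization.

(** * Bounds for the duality, and hermitian symmetry by density *)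

Section Hermitian.
Variable R : realType.
Local Notation C := R[i].
Variables (k' s' k s : R).
Variables (Hd : sobolev k' s') (H : sobolev k s) (B : L2_duality Hd H).

(** The given [M] is an arbitrary element of [R[i]], known to be nonnegative only where the product
    of the norms is nonzero: hence the case distinction and the constant |M| + 1. *)
Lemma pairing_bound : exists2 M : C, 0 < M & forall f u, `|B f u| <= M * `|f| * `|u|.
Proof.
have [M BM] := pairing_bounded B.
exists (`|M| + 1) => [|f u]; first by rewrite ltr_wpDl.
have fu0 : 0 <= `|f| * `|u| by rewrite mulr_ge0.
have := BM f u; rewrite -!mulrA.
have [-> |fu] := eqVneq (`|f| * `|u|) 0; first by rewrite !mulr0.
have fu1 : 0 < `|f| * `|u| by rewrite lt0r fu.
move=> h; apply: le_trans h _; rewrite ler_pM2r //.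
have : 0 <= M by have := le_trans (normr_ge0 _) (BM f u); rewrite -mulrA pmulr_lge0.
by move=> M0; rewrite ger0_norm // lerDl.
Qed.

Lemma pairingDl f g u : B (f + g) u = B f u + B g u.
Proof. by have := pairing_linear B u 1 f g; rewrite scale1r mul1r. Qed.

Lemma pairing0l u : B 0 u = 0.
Proof. by apply: (addIr (B 0 u)); rewrite -pairingDl addr0 add0r. Qed.

Lemma pairingZl a f u : B (a *: f) u = a * B f u.
Proof. by have := pairing_linear B u a f 0; rewrite addr0 pairing0l addr0. Qed.

Lemma pairingBl f g u : B (f - g) u = B f u - B g u.
Proof. by rewrite pairingDl -scaleN1r pairingZl mulN1r. Qed.

Lemma pairingDr f u v : B f (u + v) = B f u + B f v.
Proof. by have := pairing_conj_linear B f 1 u v; rewrite scale1r conjC1 mul1r. Qed.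

Lemma pairing0r f : B f 0 = 0.
Proof. by apply: (addIr (B f 0)); rewrite -pairingDr addr0 add0r. Qed.

Lemma pairingZr a f u : B f (a *: u) = a^* * B f u.
Proof. by have := pairing_conj_linear B f a u 0; rewrite addr0 pairing0r addr0. Qed.

Lemma pairingBr f u v : B f (u - v) = B f u - B f v.
Proof. by rewrite pairingDr -scaleN1r pairingZr conj_Creal ?realN ?real1 // mulN1r. Qed.

(** Both sides are continuous in each variable, since [W] and the pairing are bounded. Serves to
    import symmetry from an operator whose form agrees with that of [W] on Schwartz functions. *)
Lemma hermitian_of_dense (W : {linear H -> Hd}) :
  (exists2 M : C, 0 <= M & forall u, `|W u| <= M * `|u|) ->
  (forall u v, schwartz u -> schwartz v ->
    B (W (embed H u)) (embed H v) = (B (W (embed H v)) (embed H u))^*) ->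
  forall u v, B (W u) v = (B (W v) u)^*.
Proof.
move=> [M M0 WM] herm.
have [N N0 BN] := pairing_bound.
have c1 v : continuous (fun u => B (W u) v : C^o).
  apply: (@lipschitz_continuous R H C^o _ (N * M * `|v|)) => x y.
  rewrite -pairingBl -linearB; apply: le_trans (BN _ _) _.
  rewrite (_ : N * M * `|v| * `|x - y| = N * (M * `|x - y|) * `|v|); last by ring.
  by rewrite ler_wpM2r // ler_wpM2l ?(ltW N0).
have c2 f : continuous (fun u => B f u : C^o).
  apply: (@lipschitz_continuous R H C^o _ (N * `|f|)) => x y.
  by rewrite -pairingBr; exact: BN.
have cJ (F : H -> C^o) : continuous F -> continuous (fun u => (F u)^* : C^o).
  move=> cF x; apply: (@continuous_comp _ _ _ F (fun z : C^o => z^* : C^o)); first exact: cF.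
  apply: (@lipschitz_continuous R C^o C^o _ 1) => y z.
  by rewrite -rmorphB norm_conjC mul1r.
have dH := @embed_dense _ _ _ H.
move=> u v; move: v.
apply: (@dense_eq _ _ _ _ (fun v => B (W u) v : C^o) (fun v => (B (W v) u)^* : C^o) dH).
- exact: c2.
- exact: cJ.
move=> _ /set_mem[v Sv <-]; move: u.
apply: (@dense_eq _ _ _ _ (fun u => B (W u) (embed H v) : C^o)
  (fun u => (B (W (embed H v)) u)^* : C^o) dH).
- exact: c1.
- by apply: cJ; exact: c2.
by move=> _ /set_mem[u Su <-]; exact: herm.
Qed.

End Hermitian.

(** * Polarization of the expansion in l^2 *)

Section InfiniteRank.
Variable R : realType.
Local Notation C := R[i].
Variables (k' s' k s : R).
Variables (Hd : sobolev k' s') (H : sobolev k s) (B : L2_duality Hd H).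
Variable W : {linear H -> Hd}.

Lemma sum_double (F : nat -> C) n :
  \sum_(i < n.*2) F i = \sum_(m < n) (F m.*2 + F m.*2.+1).
Proof.
elim: n => [|n IH]; first by rewrite !big_ord0.
by rewrite doubleS !big_ord_recr /= IH addrA.
Qed.

Lemma factorizes_polarized (a b : nat -> H -> C) (K : C) :
  (forall n, scalar (a n)) -> (forall n, scalar (b n)) -> 0 <= K ->
  (forall u n, \sum_(i < n) `|a i u| ^+ 2 <= K * `|u| ^+ 2) ->
  (forall u n, \sum_(i < n) `|b i u| ^+ 2 <= K * `|u| ^+ 2) ->
  (forall u v, B (W u) v = (B (W v) u)^*) ->
  (forall u v (eps : C), 0 < eps -> exists N, forall n, (N <= n)%N ->
    `|B (W u) v - \sum_(i < n) a i u * (b i v)^*| < eps) ->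
  factorizes B W (@ell2_dot R).
Proof.
move=> alin blin K0 aK bK herm abW.
pose l i u : C := 2^-1 * (a i./2 u + (-1) ^+ i * b i./2 u).
have sign2 m : (-1) ^+ m.*2 = 1 :> C by rewrite -muln2 exprM sqrr_sign.
have le m u : l m.*2 u = 2^-1 * (a m u + b m u).
  by rewrite /l doubleK sign2 mul1r.
have lo m u : l m.*2.+1 u = 2^-1 * (a m u - b m u).
  by rewrite /l -[m.*2.+1]/(true + m.*2)%N half_bit_double exprS sign2 mulr1 mulN1r.
apply: (@factorizes_ell2 R _ _ _ _ _ _ B W l K) => //.
- move=> i c u v; rewrite /l alin blin; ring.
- move=> u n; apply: (@le_trans _ _ (\sum_(i < n.*2) `|l i u| ^+ 2)).
    have nn : (n <= n.*2)%N by rewrite -addnn leq_addr.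
    rewrite -!(big_mkord xpredT (fun i => `|l i u| ^+ 2)) (big_cat_nat _ nn) //= lerDl.
    by apply: sumr_ge0 => i _; exact: exprn_ge0.
  rewrite (sum_double (fun i => `|l i u| ^+ 2)).
  (* Parallelogram law: |a+b|^2/4 + |a-b|^2/4 = (|a|^2 + |b|^2)/2, so the constant [K] is kept. *)
  rewrite (eq_bigr (fun i : 'I_n => 2^-1 * `|a i u| ^+ 2 + 2^-1 * `|b i u| ^+ 2)).
    rewrite big_split /= -!mulr_sumr [leRHS](_ : _ = 2^-1 * (K * `|u| ^+ 2) + 2^-1 * (K * `|u| ^+ 2)).
      by apply: lerD; rewrite ler_pM2l ?invr_gt0 ?aK ?bK.
    by field.
  have n2 : `|2^-1 : C| = 2^-1 by rewrite ger0_norm ?invr_ge0.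
  move=> i _; rewrite le lo !normrM !exprMn n2 !normCK.
  have -> : (a i u - b i u)^* = (a i u)^* - (b i u)^* by exact: rmorphB.
  by rewrite conjC_add; field.
- move=> u v eps e0.
  have [N1 h1] := abW u v _ e0; have [N2 h2] := abW v u _ e0.
  exists (maxn N1 N2) => n; rewrite geq_max => /andP[/h1 n1 /h2 n2].
  rewrite (sum_double (fun i => (-1) ^+ i * l i u * (l i v)^*)); set z := (X in X < _).
  (* The error is the mean of the error at (u, v) and of the conjugate of the error at (v, u), by
     hermitian symmetry. *)
  apply: (@le_lt_trans _ _ (2^-1 * (`|B (W u) v - \sum_(i < n) a i u * (b i v)^*| +
      `|B (W v) u - \sum_(i < n) a i v * (b i u)^*|))); last first.
    by rewrite mulrC ltr_pdivrMr // [ltRHS](_ : _ = eps + eps) ?ltrD //; ring.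
  rewrite -[X in _ + X]norm_conjC -[X in X * _]ger0_norm ?invr_ge0 //.
  apply: le_trans (ler_wpM2l _ (ler_normD _ _)) => //.
  rewrite /z -normrM le_eqVlt; apply/orP; left; apply/eqP; congr (`|_|).
  have -> : (B (W v) u - \sum_(i < n) a i v * (b i u)^*)^* =
      B (W u) v - \sum_(i < n) b i u * (a i v)^*.
    rewrite rmorphB rmorph_sum /= -herm; congr (_ - _); apply: eq_bigr => i _.
    by rewrite (conjC_mul (a i v)) conjCK mulrC.
  rewrite (_ : \sum_(m < n) _ = 2^-1 * (\sum_(i < n) a i u * (b i v)^*) +
      2^-1 * (\sum_(i < n) b i u * (a i v)^*)). 
    by field.
  rewrite !mulr_sumr -big_split /=; apply: eq_bigr => i _.
  rewrite !le !lo exprS sign2 mulr1 mul1r.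
  have h2' : (2^-1 : C)^* = 2^-1 by rewrite conj_Creal // realV realn.
  rewrite !(conjC_mul 2^-1) h2' conjC_add.
  have -> : (a i v - b i v)^* = (a i v)^* - (b i v)^* by exact: rmorphB.
  by field.
Qed.

Hypothesis polar : polar_linear Hd.

Lemma factorizes_compact : compact_operator W ->
  (forall u v, B (W u) v = (B (W v) u)^*) ->
  factorizes B W (@ell2_dot R).
Proof.
move=> cW herm.
have [M M0 WM] := compact_operator_bounded cW.
have [N N0 BN] := pairing_bound B.
have [d Wd] := compact_operator_separable cW.
pose e := gram d.
have e01 : forall i, e i = 0 \/ `|e i| = 1 by exact: gram01.
have eorth : forall i j, i != j -> pform (e i) (e j) = 0 by exact: gram_orth.
(* M^2 serves the first family, by Bessel's inequality, and N^2 the second, by duality. *)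
apply: (@factorizes_polarized (fun n u => pform (W u) (e n)) (fun n u => (B (e n) u)^*)
  (M ^+ 2 + N ^+ 2)) => //.
- by move=> n c u v; rewrite linearP (pformDl polar) (pformZl polar).
- by move=> n c u v; rewrite pairing_conj_linear conjC_add (conjC_mul c^*) conjCK.
- by rewrite addr_ge0 // exprn_ge0 // ltW.
- move=> u n; apply: le_trans (bessel_inequality polar e01 eorth (W u) n) _.
  apply: (@le_trans _ _ (M ^+ 2 * `|u| ^+ 2)).
    by rewrite -exprMn ler_pXn2r ?nnegrE ?mulr_ge0.
  by rewrite ler_wpM2r ?exprn_ge0 // lerDl exprn_ge0 // ltW.
- move=> u n; apply: (@le_trans _ _ (N ^+ 2 * `|u| ^+ 2)); last first.
    by rewrite ler_wpM2r ?exprn_ge0 // lerDr exprn_ge0.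
  set S := \sum_(i < n) _.
  have S0 : 0 <= S by apply: sumr_ge0 => i _; exact: exprn_ge0.
  (* Pairing this combination with [u] gives S, while |g|^2 <= S. Hence S^2 <= N^2 S |u|^2, and a
     factor S cancels. *)
  pose g := osum e (fun i => (B (e i) u)^*) n.
  have Sg : B g u = S.
    rewrite /g /osum (pairing_sum B n (fun i => (B (e i) u)^*) e) /S; apply: eq_bigr => i _.
    by rewrite normCK conjCK mulrC.
  have gS : `|g| ^+ 2 <= S by exact: (sqr_norm_osum_le polar).
  have [->|Sn0] := eqVneq S 0; first by rewrite mulr_ge0 ?exprn_ge0 // ltW.
  have Sp : 0 < S by rewrite lt0r Sn0.
  have h1 : S ^+ 2 <= (N * `|g| * `|u|) ^+ 2.
    by rewrite ler_pXn2r ?nnegrE ?mulr_ge0 ?(ltW N0) // -{1}(ger0_norm S0) -Sg.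
  rewrite -(ler_pM2r Sp) -expr2; apply: le_trans h1 _.
  rewrite (_ : (N * `|g| * `|u|) ^+ 2 = N ^+ 2 * `|u| ^+ 2 * `|g| ^+ 2); last by ring.
  by apply: ler_wpM2l => //; rewrite mulr_ge0 ?exprn_ge0 // ltW.
- move=> u v eps e0.
  (* |v| + 1 in place of |v| keeps the divisor positive. *)
  have Nv : 0 < N * (`|v| + 1) by rewrite mulr_gt0 // ltr_wpDl.
  have [n0 hn] := oproj_gram_cvg polar (Wd u) (divr_gt0 e0 Nv).
  exists n0 => n /hn; rewrite ltr_pdivlMr // => hlt; apply: le_lt_trans hlt.
  rewrite (_ : \sum_(i < n) _ = B (oproj e (W u) n) v).
    rewrite -pairingBl; apply: le_trans (BN _ _) _.
    by rewrite mulrC mulrA mulrC ler_wpM2l // mulrC ler_wpM2l ?(ltW N0) // lerDl.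
  rewrite /oproj /osum (pairing_sum B n (fun i => pform (W u) (e i)) e); apply: eq_bigr => i _.
  by rewrite conjCK.
Qed.

End InfiniteRank.

(** * Finite rank *)

Section FiniteRank.
Variable R : realType.
Local Notation C := R[i].
Variables (k' s' k s : R).
Variables (Hd : sobolev k' s') (H : sobolev k s) (B : L2_duality Hd H).
Variable W : {linear H -> Hd}.
Local Open Scope sesquilinear_scope.

Lemma factorizes_Cn (n : nat) (l : 'I_n -> H -> C) (sg : 'I_n -> C) (K : 'I_n -> C) :
  (forall i, scalar (l i)) -> (forall i, 0 <= K i) ->
  (forall i u, `|l i u| <= K i * `|u|) ->
  (forall i, sg i = 1 \/ sg i = -1) ->
  (forall u v, B (W u) v = \sum_i sg i * l i u * (l i v)^*) ->
  factorizes B W (@Cn_dot R n).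
Proof.
move=> llin K0 lK sg1 BW.
have sgC i : (sg i)^* = sg i.
  by case: (sg1 i) => ->; rewrite ?conjC1 // conj_Creal // realN real1.
have sgK i : sg i * sg i = 1 by case: (sg1 i) => ->; rewrite ?mulr1 // mulrNN mulr1.
pose w0 u : 'rV[C]_n := \row_i l i u.
have wlin : linear w0.
  by move=> c u v; apply/rowP => i; rewrite !mxE llin.
pose wl := GRing.isLinear.Build C H 'rV[C]_n *:%R w0 wlin.
pose w : {linear H -> 'rV[C]_n} := HB.pack_for {linear H -> 'rV[C]_n} w0 wl.
pose U0 (a : 'rV[C]_n) : 'rV[C]_n := \row_i (sg i * a 0 i).
have Ulin : linear U0.
  by move=> c a b; apply/rowP => i; rewrite !mxE; ring.
pose Ul := GRing.isLinear.Build C 'rV[C]_n 'rV[C]_n *:%R U0 Ulin.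
pose U : {linear 'rV[C]_n -> 'rV[C]_n} := HB.pack_for {linear 'rV[C]_n -> 'rV[C]_n} U0 Ul.
apply: (@factorizes_intro _ _ _ _ _ _ _ B W 'rV[C]_n (@Cn_dot R n) w U).
- move=> c a b d; rewrite /Cn_dot mulr_sumr -big_split /=; apply: eq_bigr => i _.
  by rewrite !mxE; ring.
- move=> c a b d; rewrite /Cn_dot mulr_sumr -big_split /=; apply: eq_bigr => i _.
  by rewrite !mxE conjC_add (conjC_mul c); ring.
- exists (sqrtC (\sum_i K i ^+ 2)) => u.
  have S0 : 0 <= \sum_i K i ^+ 2 by apply: sumr_ge0 => i _; exact: exprn_ge0.
  have -> : sqrtC (\sum_i K i ^+ 2) * `|u| = sqrtC ((\sum_i K i ^+ 2) * `|u| ^+ 2).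
    by rewrite (@sqrtCM _ (\sum_i K i ^+ 2)) ?nnegrE ?exprn_ge0 // sqrCK.
  have dE : Cn_dot (w u) (w u) = \sum_i `|l i u| ^+ 2.
    by apply: eq_bigr => i _; rewrite normCK !mxE.
  have d0 : 0 <= \sum_i `|l i u| ^+ 2 by apply: sumr_ge0 => i _; exact: exprn_ge0.
  rewrite dE ler_sqrtC ?nnegrE ?mulr_ge0 ?exprn_ge0 // mulr_suml.
  apply: ler_sum => i _; rewrite -exprMn ler_pXn2r ?nnegrE ?mulr_ge0 //.
- move=> a; exists (\sum_i `|a 0 i| * K i) => u; rewrite mulr_suml.
  apply: le_trans (ler_norm_sum _ _ _) _; apply: ler_sum => i _.
  by rewrite !mxE normrM norm_conjC -mulrA ler_wpM2l.
- move=> a b; apply: eq_bigr => i _; rewrite !mxE (conjC_mul (sg i)) sgC; ring.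
- move=> a b; apply: eq_bigr => i _; rewrite !mxE (conjC_mul (sg i)) sgC.
  by rewrite mulrCA -!mulrA (mulrA (sg i)) sgK mul1r mulrC.
- move=> b; exists (U0 b); apply/rowP => i; rewrite !mxE mulrA sgK mul1r //.
- by move=> u v; rewrite BW; apply: eq_bigr => i _; rewrite !mxE.
Qed.

Hypothesis herm : forall u v, B (W u) v = (B (W v) u)^*.

Hypothesis Wbounded : exists2 M : C, 0 <= M & forall u, `|W u| <= M * `|u|.

(** With W p_j = e_j, put a_j(u) = <W u, p_j>; these coordinates are visibly linear and bounded,
    unlike the chosen coefficients d(u) of W u. Since a(u) = d(u) G for the Gram matrix G, the form
    is a(u) A a(v)* with A the inverse of G. Diagonalizing A, the square roots of the |eigenvalues|
    go into w and their signs into U. *)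
Lemma factorizes_finite_rank (n : nat) : has_rank W n -> factorizes B W (@Cn_dot R n).
Proof.
move=> [e [efree We]].
have [M M0 WM] := Wbounded; have [N N0 BN] := pairing_bound B.
have dE v : exists d : 'I_n -> C, W v = \sum_i d i *: e i.
  have : range W (W v) by exists v.
  by rewrite We => -[d _ <-]; exists d.
have /choice[p pE] : forall i, exists u, W u = e i.
  move=> i; have : range W (e i).
    rewrite We; exists (fun j => (j == i)%:R) => //.
    rewrite (bigD1 i) //= eqxx scale1r big1 ?addr0 // => j /negPf ->.
    by rewrite scale0r.
  by case=> u _ ue; exists u.
pose a u : 'rV[C]_n := \row_j B (W u) (p j).
have BW u v (d : 'I_n -> C) : W v = \sum_i d i *: e i ->
    B (W u) v = \sum_j a u 0 j * (d j)^*.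
  move=> vd; rewrite herm vd.
  have -> : B (\sum_i d i *: e i) u = \sum_i d i * B (e i) u.
    by elim/big_rec2: _ => [|i x y _ <-]; rewrite ?pairing0l // pairingDl pairingZl.
  rewrite rmorph_sum; apply: eq_bigr => j _ /=.
  by rewrite (conjC_mul (d j)) mulrC !mxE herm pE.
pose G : 'M[C]_n := \matrix_(i, j) B (e i) (p j).
have aG u (d : 'I_n -> C) : W u = \sum_i d i *: e i -> a u = (\row_i d i) *m G.
  move=> ud; apply/rowP => j; rewrite !mxE ud.
  have -> : B (\sum_i d i *: e i) (p j) = \sum_i d i * B (e i) (p j).
    by elim/big_rec2: _ => [|i x y _ <-]; rewrite ?pairing0l // pairingDl pairingZl.
  by apply: eq_bigr => i _; rewrite !mxE.
have Gherm : G ^t* = G.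
  by apply/matrixP => i j; rewrite !mxE -!pE -herm.
(* If x G = 0, then W applied to the combination of the p_i with coefficients x pairs to 0 with
   every vector, hence vanishes, and x = 0 by freeness of [e]. *)
have Gu : G \in unitmx.
  rewrite -row_free_unit -kermx_eq0; apply/rowV0P => x /sub_kermxP xG.
  pose u := \sum_i x 0 i *: p i.
  have Wu : W u = \sum_i x 0 i *: e i.
    by rewrite linear_sum; apply: eq_bigr => i _; rewrite linearZ /= pE.
  have au : a u = 0.
    by rewrite (aG _ _ Wu) -[RHS]xG; congr (_ *m _); apply/rowP => i; rewrite mxE.
  have W0 : W u = 0.
    apply: (pairing_eqP (B := B)) => v; have [d vd] := dE v.
    by rewrite (BW _ _ _ vd) au pairing0l big1 // => i _; rewrite mxE mul0r.
  by apply/rowP => i; rewrite mxE; apply: (efree (fun i => x 0 i)); rewrite -Wu.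
pose A := invmx G.
have Aherm : A ^t* = A.
  rewrite /A trmx_inv map_invmx; congr invmx; exact: Gherm.
have BWA u v : B (W u) v = (a u *m A *m (a v) ^t*) 0 0.
  have [d vd] := dE v.
  have dA : \row_i d i = a v *m A by rewrite (aG _ _ vd) mulmxK.
  rewrite (BW _ _ _ vd) -mulmxA -{1}Aherm -map_mxM -trmx_mul -dA mxE.
  by apply: eq_bigr => j _; rewrite !mxE.
have Ah : A \is hermsymmx by rewrite is_hermitianmxE expr0 scale1r Aherm.
have /orthomx_spectralP AE := hermitian_normalmx Ah.
have Dreal := hermitian_spectral_diag_real Ah.
set P := spectralmx A in AE; set D := spectral_diag A in AE Dreal.
have Dr i : D 0 i \is Num.real by have /mxOverP := Dreal; apply.
pose y u : 'rV[C]_n := a u *m P ^t*.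
have BWy u v : B (W u) v = \sum_i D 0 i * y u 0 i * (y v 0 i)^*.
  rewrite BWA AE invmx_unitary ?spectral_unitarymx //.
  rewrite !mulmxA -/(y u) -mulmxA.
  have -> : P *m (a v) ^t* = (y v) ^t*.
    by rewrite /y trmx_mul map_mxM trmxCK.
  rewrite mul_mx_diag [LHS]mxE; apply: eq_bigr => i _.
  by rewrite [X in X * _]mxE (mulrC (D 0 i)); congr (_ * _); rewrite 2!mxE.
(* The value is 1 or -1 even at an eigenvalue 0, as a unitary diagonal [U] requires. *)
pose sg i : C := if D 0 i < 0 then -1 else 1.
pose l i u := sqrtC `|D 0 i| * y u 0 i.
have alin c u v : a (c *: u + v) = c *: a u + a v.
  by apply/rowP => j; rewrite !mxE linearP pairing_linear.
have ylin c u v : y (c *: u + v) = c *: y u + y v.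
  by rewrite /y alin mulmxDl scalemxAl.
have abound j u : `|a u 0 j| <= N * (M * `|u|) * `|p j|.
  by rewrite mxE; apply: le_trans (BN _ _) _; rewrite ler_wpM2r // ler_wpM2l ?(ltW N0).
pose K i := sqrtC `|D 0 i| * \sum_j N * M * `|p j| * `|P^t* j i|.
have sqrt0 i : 0 <= sqrtC `|D 0 i| by rewrite sqrtC_ge0.
apply: (@factorizes_Cn n l sg K).
- by move=> i c u v; rewrite /l ylin 2!mxE; ring.
- move=> i; rewrite mulr_ge0 ?sqrtC_ge0 // sumr_ge0 // => j _.
  by rewrite !mulr_ge0 // ltW.
- move=> i u; rewrite /l normrM (ger0_norm (sqrt0 i)) /K -mulrA ler_wpM2l //.
  rewrite /y mxE mulr_suml; apply: le_trans (ler_norm_sum _ _ _) _.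
  apply: ler_sum => j _; rewrite normrM.
  have := ler_wpM2r (normr_ge0 (P^t* j i)) (abound j u).
  by rewrite (_ : N * (M * `|u|) * `|p j| * _ = N * M * `|p j| * `|P^t* j i| * `|u|) //; ring.
- by move=> i; rewrite /sg; case: ifP; [right|left].
- move=> u v; rewrite BWy; apply: eq_bigr => i _; rewrite /l.
  rewrite (conjC_mul (sqrtC `|D 0 i|)) (conj_Creal (ger0_real (sqrt0 i))).
  have sgD : D 0 i = sg i * (sqrtC `|D 0 i| * sqrtC `|D 0 i|).
    rewrite -expr2 sqrtCK /sg; case: ifPn => [D0|].
      by rewrite ltr0_norm // mulN1r opprK.
    by rewrite -real_leNgt ?real0 // => D0; rewrite ger0_norm // mul1r.
  by rewrite {1}sgD; ring.
Qed.

End FiniteRank.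

Theorem lemma7p2 (R : realType) (beta : R)
    (H1 : sobolev (1 : R) 0) (Hm1 : sobolev (-1 : R) 0) (B0 : L2_duality Hm1 H1)
    (H1w : sobolev (1 : R) (- (beta / 2))) (Hm1w : sobolev (-1 : R) (beta / 2))
    (B : L2_duality Hm1w H1w)
    (W0 : {linear H1 -> Hm1}) (W : {linear H1w -> Hm1w}) :
  0 < beta ->
  symmetric_form_compact B0 W0 ->
  same_form B0 B W0 W ->
  compact_operator W ->
  (infinite_rank W -> factorizes B W (@ell2_dot R)) /\
  (forall n : nat, has_rank W n -> factorizes B W (@Cn_dot R n)).
Proof.
move=> _ [sym _] same cW.
have Wb := compact_operator_bounded cW.
have herm : forall u v, B (W u) v = (B (W v) u)^*.
  (* On Schwartz functions the form of [W] is that of [W0], which is symmetric. *)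
  apply: hermitian_of_dense Wb _ => u v Su Sv.
  by rewrite -!same //; exact: sym.
split=> [_|n rW]; last exact: factorizes_finite_rank herm Wb n rW.
(* [sobolev_polar] applies because [Hm1w] has order -1 <= 0. *)
apply: factorizes_compact cW herm => r f h g /RRe_real <-.
by apply: sobolev_polar; rewrite lerN10.
Qed.
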